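(* Consider the Polyhedral Clinching Auction run on the modified market as described in the context, with all participants reporting truthfully. Then $${\rm SW}^{\rm PCA}=\sum_{i\in N}v_ix^{\rm f}_i\ \ge\ \sum_{i\in N}v_ix^*_i={\rm LW}^{\rm OPT}.$$
   Context: Market model. Buyers $N_0=\{1,\dots,n\}$, sellers $M=\{1,\dots,m\}$, bipartite edge set $E_0\subseteq N_0\times M$; edge $(i,j)$ written $ij$; for a set $S$ of participants $E_S$ is the set of edges incident to a member of $S$ ($E_i=E_{\{i\}}$); $w(F)=\sum_{e\in F}w_e$. Each seller $j$ has a monotone submodular $f_j:2^{E_j}\to\mathbb R_+$, $f_j(\emptyset)=0$ ($f_j(E_j)$ = her total amount of a homogeneous divisible good). Buyer $i$ has per-unit valuation $v_i>0$ and budget $B_i\ge0$; seller $j$ has per-unit valuation $\rho_j>0$. Modified market. For each seller $j$ add a virtual buyer $n+j$ adjacent only to $j$ with $v_{n+j}=\rho_j$, $B_{n+j}=\infty$; $N=\{1,\dots,n+m\}$, $E=E_0\cup\{(n+j)j\}$; extend $f_j$ by $f_j(F)=f_j(E_j)$ if $(n+j)j\in F$, unchanged otherwise; $P_j=\{y\in\mathbb R^{E_j}_+:y(F)\le f_j(F)\ \forall F\}$, $P=\{w\in\mathbb R^E_+:w|_{E_j}\in P_j\ \forall j\}$, $f(S)=\sum_jf_j(S\cap E_j)$. The amount $w_{(n+j)j}$ represents goods seller $j$ keeps, so social welfare is $\sum_{i\in N}v_iw(E_i)$ and liquid welfare $\sum_{i\in N}\min(v_iw(E_i),B_i)$. For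 $i\in N$, $H_i$ is the set of buyers $k$ with $v_k>v_i$, or $v_k=v_i$ and $k<i$; $x^*\in\mathbb R^N_+$ is defined recursively (decreasing valuation, ties by index) by $x^*_i=\min(B_i/v_i,\min_{H\subseteq H_i}\{f(E_{H\cup\{i\}})-x^*(H)\})$; ${\rm LW}^{\rm OPT}=\max_{w\in P}\sum_{i\in N}\min(v_iw(E_i),B_i)$. Polyhedral Clinching Auction (PCA) with step $\varepsilon>0$: bids $v'_i$ for $i\in N$ (virtual buyer $n+j$ bids seller $j$'s bid), all assumed to be positive integer multiples of $\varepsilon$. State: $w\in\mathbb R^E_+$, payments $p$, revenues $r$, price clocks $c_i$, demands $d_i\in[0,\infty]$; initially $w=0,p=0,r=0$, $c_i=0$, $d_i=\infty$, pointer $l=1$. For $w,d$ let $P_{w,d}=\{y\in\mathbb R^E_+: w+y\in P,\ y(E_k)\le d_k\ \forall k\}$ and for $\xi\in\mathbb R^{E_i}_+$ let $P^i_{w,d}(\xi)=\{u\in\mathbb R^{N\setminus\{i\}}_+:\exists y\in P_{w,d},\ y|_{E_i}=\xi,\ y(E_k)=u_k\ \forall k\ne i\}$. While some $d_i\neq 0$, an iteration does: (1) clinching step: for $i=1,\dots,n+m$ in turn, choose a maximal $\xi_i\in\mathbb R^{E_i}_+$ with $P^i_{w,d}(\xi_i)=P^i_{w,d}(0)$, set $p_i\leftarrow p_i+c_i\xi_i(E_i)$, $w_{ij}\leftarrow w_{ij}+\xi_{ij}$, and reset every demand to $d_k=(B_k-p_k)/c_k$ if $c_k<v'_k$ and $d_k=0$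 otherwise ($d_k=\infty$ while $c_k=0$); then $r_j\leftarrow r_j+\sum_{ij\in E_j}c_i\xi_{ij}$; (2) $c_l\leftarrow c_l+\varepsilon$ and $d_l\leftarrow(B_l-p_l)/c_l$ if $c_l<v'_l$, else $d_l\leftarrow0$; (3) advance $l$ cyclically. For $i\in N$, $x^{\rm f}_i$ denotes the value of $w(E_i)$ at termination, and ${\rm SW}^{\rm PCA}=\sum_{i\in N}v_ix^{\rm f}_i$. Truthful reporting means $v'_i=v_i$ for all $i\in N$. *)

(* Defs.v *)
From HB Require Import structures.
From mathcomp Require Import all_boot all_order all_algebra.
From mathcomp Require Import reals.
Set Implicit Arguments. Unset Strict Implicit. Unset Printing Implicit Defensive.
Import Order.TTheory GRing.Theory Num.Theory.
Local Open Scope ring_scope.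

(* Original market data.  Buyers are 'I_nB (paper: 1..n), sellers are   *)
(* 'I_nS (paper: 1..m).  adj i j <=> ij \in E_0.  fS j is seller j's    *)
(* function f_j; only its values on subsets of E_j matter.              *)
Record market (R : realType) := Market {
  nB : nat; nS : nat;
  adj : 'I_nB -> 'I_nS -> bool;
  fS : 'I_nS -> {set 'I_nB * 'I_nS} -> R;
  vB : 'I_nB -> R;
  bB : 'I_nB -> R;
  rhoS : 'I_nS -> R }.
Arguments nB {R} m. Arguments nS {R} m. Arguments adj {R} m _ _.
Arguments fS {R} m _ _. Arguments vB {R} m _. Arguments bB {R} m _.
Arguments rhoS {R} m _.

Definition E0j R (M : market R) (j : 'I_(nS M)) : {set 'I_(nB M) * 'I_(nS M)} :=
  [set e | adj M e.1 e.2 && (e.2 == j)].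

Definition market_wf R (M : market R) : Prop :=
  (forall i, 0 < vB M i) /\ (forall i, 0 <= bB M i) /\ (forall j, 0 < rhoS M j) /\
  forall j,
    fS M j set0 = 0 /\
    (forall F : {set 'I_(nB M) * 'I_(nS M)}, F \subset E0j j -> 0 <= fS M j F) /\
    (forall F G : {set 'I_(nB M) * 'I_(nS M)}, F \subset G -> G \subset E0j j -> fS M j F <= fS M j G) /\
    (forall F G : {set 'I_(nB M) * 'I_(nS M)}, F \subset E0j j -> G \subset E0j j ->
       fS M j (F :|: G) + fS M j (F :&: G) <= fS M j F + fS M j G).

(* Modified market.  Participants N = 'I_(nB+nS): index k < nB is the  *)
(* real buyer k, index nB + j is the virtual buyer of seller j          *)
(* (paper: n + j).  Edges are pairs (k, j) satisfying inE.              *)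
Notation agent M := 'I_(nB M + nS M).
Notation edge M := (agent M * 'I_(nS M))%type.

Definition real R (M : market R) (i : 'I_(nB M)) : agent M := lshift (nS M) i.
Definition virt R (M : market R) (j : 'I_(nS M)) : agent M := rshift (nB M) j.

Definition inE R (M : market R) (e : edge M) : bool :=
  match split e.1 with inl i => adj M i e.2 | inr j => j == e.2 end.

Definition Eset R (M : market R) (S : {set agent M}) : {set edge M} :=
  [set e | inE e && (e.1 \in S)].
Definition Ei R (M : market R) (k : agent M) : {set edge M} := Eset [set k].
Definition Ej R (M : market R) (j : 'I_(nS M)) : {set edge M} :=
  [set e | inE e && (e.2 == j)].

Definition orig R (M : market R) (F : {set edge M}) : {set 'I_(nB M) * 'I_(nS M)} :=
  [set e | (real e.1, e.2) \in F].

Definition fmod R (M : market R) (j : 'I_(nS M)) (F : {set edge M}) : R :=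
  if (virt j, j) \in F then fS M j (E0j j) else fS M j (orig F).

Definition fsum R (M : market R) (S : {set edge M}) : R :=
  \sum_(j < nS M) fmod j (S :&: Ej j).

Definition wsum R (M : market R) (w : edge M -> R) (F : {set edge M}) : R :=
  \sum_(e in F) w e.

(* valuations and budgets in the modified market; None = +infinity *)
Definition vN R (M : market R) (k : agent M) : R :=
  match split k with inl i => vB M i | inr j => rhoS M j end.
Definition bN R (M : market R) (k : agent M) : option R :=
  match split k with inl i => Some (bB M i) | inr _ => None end.

(* w \in P (vectors in R^E are functions on pairs vanishing off E) *)
Definition inP R (M : market R) (w : edge M -> R) : Prop :=
  (forall e, ~~ inE e -> w e = 0) /\ (forall e, 0 <= w e) /\
  forall j (F : {set edge M}), F \subset Ej j -> wsum w F <= fmod j F.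

Definition LW R (M : market R) (w : edge M -> R) : R :=
  \sum_(k : agent M)
    match bN k with
    | Some b => Num.min (vN k * wsum w (Ei k)) b
    | None => vN k * wsum w (Ei k)
    end.

Definition Hset R (M : market R) (i : agent M) : {set agent M} :=
  [set k | (vN i < vN k) || ((vN k == vN i) && (nat_of_ord k < nat_of_ord i)%N)].

Definition xstar_val R (M : market R) (x : agent M -> R) (i : agent M) : R :=
  let cap := \big[Num.min/fsum (Eset [set i])]_(H in powerset (Hset i))
               (fsum (Eset (i |: H)) - \sum_(k in H) x k) in
  match bN i with Some b => Num.min (b / vN i) cap | None => cap end.

(* recursion along the order: at step t the participant with exactly t
   predecessors (|H_i| = t) gets its value *)
Fixpoint xstar_iter R (M : market R) (t : nat) : {ffun agent M -> R} :=
  match t with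
  | 0 => [ffun _ => 0]
  | t'.+1 => let x := xstar_iter M t' in
             [ffun k => if #|Hset k| == t' then xstar_val x k else x k]
  end.

Definition xstar R (M : market R) : agent M -> R := xstar_iter M (nB M + nS M).

Record pstate R (M : market R) := St {
  sw : edge M -> R;
  sp : agent M -> R;
  sc : agent M -> R;
  sd : agent M -> option R;  (* demands d, None = +infinity *)
  sl : nat }.                (* pointer l (0-based) *)

Definition demand R (M : market R) (v' : agent M -> R) (p c : agent M -> R)
  (k : agent M) : option R :=
  if c k == 0 then None
  else if c k < v' k then
         match bN k with Some b => Some ((b - p k) / c k) | None => None end
       else Some 0.

Definition le_dem (R : realType) (x : R) (d : option R) : Prop :=
  match d with None => True | Some b => x <= b end.

Definition inPwd R (M : market R) (w : edge M -> R) (d : agent M -> option R)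
  (y : edge M -> R) : Prop :=
  (forall e, ~~ inE e -> y e = 0) /\ (forall e, 0 <= y e) /\
  inP (fun e => w e + y e) /\ forall k, le_dem (wsum y (Ei k)) (d k).

(* u \in P^i_{w,d}(xi); u : N -> R, its i-th coordinate is ignored *)
Definition inPi R (M : market R) (w : edge M -> R) (d : agent M -> option R)
  (i : agent M) (xi : edge M -> R) (u : agent M -> R) : Prop :=
  (forall k, k != i -> 0 <= u k) /\
  exists y, inPwd w d y /\ (forall e, e \in Ei i -> y e = xi e) /\
            forall k, k != i -> wsum y (Ei k) = u k.

Definition clinchable R (M : market R) (w : edge M -> R) (d : agent M -> option R)
  (i : agent M) (xi : edge M -> R) : Prop :=
  (forall e, e \notin Ei i -> xi e = 0) /\ (forall e, 0 <= xi e) /\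
  forall u, inPi w d i xi u <-> inPi w d i (fun _ => 0) u.

Definition max_clinch R (M : market R) (w : edge M -> R) (d : agent M -> option R)
  (i : agent M) (xi : edge M -> R) : Prop :=
  clinchable w d i xi /\
  forall xi', clinchable w d i xi' -> (forall e, xi e <= xi' e) -> forall e, xi' e = xi e.

Definition clinch_one R (M : market R) (v' : agent M -> R) (i : agent M)
  (s s' : pstate M) : Prop :=
  exists xi, max_clinch (sw s) (sd s) i xi /\
    let p' := fun k => if k == i then sp s k + sc s k * wsum xi (Ei i) else sp s k in
    s' = St (fun e => sw s e + xi e) p' (sc s) (demand v' p' (sc s)) (sl s).

Fixpoint clinch_seq R (M : market R) (v' : agent M -> R) (l : seq (agent M))
  (s s' : pstate M) : Prop :=
  match l with
  | [::] => s' = s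
  | i :: l' => exists s1, clinch_one v' i s s1 /\ clinch_seq v' l' s1 s'
  end.

Definition price_step R (M : market R) (v' : agent M -> R) (eps : R)
  (s : pstate M) : pstate M :=
  let c' := fun k : agent M => if nat_of_ord k == sl s then sc s k + eps else sc s k in
  St (sw s) (sp s) c'
     (fun k => if nat_of_ord k == sl s then demand v' (sp s) c' k else sd s k)
     ((sl s).+1 %% (nB M + nS M)).

Definition pca_iter R (M : market R) (v' : agent M -> R) (eps : R)
  (s s' : pstate M) : Prop :=
  exists s1, clinch_seq v' (enum 'I_(nB M + nS M)) s s1 /\ s' = price_step v' eps s1.

Inductive pca_runs R (M : market R) (v' : agent M -> R) (eps : R) :
  pstate M -> pstate M -> Prop :=
| run_stop s : (forall k, sd s k = Some 0) -> pca_runs v' eps s s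
| run_step s s1 s2 : (exists k, sd s k <> Some 0) -> pca_iter v' eps s s1 ->
    pca_runs v' eps s1 s2 -> pca_runs v' eps s s2.

Definition pca_init R (M : market R) : pstate M :=
  St (fun _ => 0) (fun _ => 0) (fun _ => 0) (fun _ => None) 0.

Definition xf R (M : market R) (s : pstate M) (k : agent M) : R := wsum (sw s) (Ei k).
Definition SW_PCA R (M : market R) (s : pstate M) : R := \sum_(k : agent M) vN k * xf s k.

Definition is_LWOPT R (M : market R) (X : R) : Prop :=
  (exists w : edge M -> R, inP w /\ LW w = X) /\ (forall w : edge M -> R, inP w -> LW w <= X).

(* Main.v *)
Require Import Defs.
From HB Require Import structures.
From mathcomp Require Import all_boot all_order all_algebra.
From mathcomp Require Import reals ring lra.
Import Order.TTheory GRing.Theory Num.Theory.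
Local Open Scope ring_scope.
Set Implicit Arguments. Unset Strict Implicit. Unset Printing Implicit Defensive.

(** Write [E_S] for the edges at the agents in [S].  A demand vector [u] is
    realizable on top of an allocation [w] iff [u(S) + w(F) <= f(F)] whenever
    [F] contains [E_S] (edges are given their amounts one at a time; submodularity
    keeps the lower bounds below the upper bounds).  In these aggregated terms a
    clinch of amount [a] by [i] just replaces the set [D] of realizable vectors
    within the demands by [{u >= 0 | u + a e_i \in D}].

    Two consequences drive the proof.  First, refunding all past clinches of any
    set of agents never enlarges what the others can still get.  Second, once [k]
    cannot clinch any more, the largest total over [D] is attained with [u_k = 0];
    so after a clinching round, with [A] the agents of nonzero demand, no demand in
    [A] binds and the whole residual [f(E_A) - w(E_A)] is realizable within [A].
    Later clinches and price steps preserve this, hence [E_A] is exactly exhausted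
    at termination.  If [l] drops out at price [v_l] with budget left, the clocks
    force [v_k >= v_l] on [A].  Thus every [l] either has [x_l >= B_l / v_l] or lies
    in a tight set of agents valued at least [v_l], so the final allocation
    dominates [x*] on every upper level set of [v]; Abel summation gives the
    inequality.  The same domination argument, applied to the greedy vector [x*],
    shows its optimality. *)

(** * Sums over finite sets *)

Section SetSums.
Variables (R : realFieldType) (T : finType).
Implicit Types (u v : T -> R) (S A : {set T}).

Lemma sum_setUI u S A :
  \sum_(k in S :|: A) u k + \sum_(k in S :&: A) u k =
  \sum_(k in S) u k + \sum_(k in A) u k.
Proof.
rewrite !(big_mkcond (fun k => k \in _)) -!big_split /=.
by apply: eq_bigr => k _; rewrite !inE; case: (k \in S); case: (k \in A) => /=; ring.
Qed.

Lemma sum_delta (a : R) (e : T) S :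
  \sum_(k in S) (if k == e then a else 0) = if e \in S then a else 0.
Proof.
rewrite -big_mkcondr /=; case: ifP => eS.
  by rewrite (big_pred1 e) // => k; rewrite /= andbC; case: eqP => [->|].
by rewrite big_pred0 // => k; rewrite andbC; case: eqP => [->|].
Qed.

Lemma ler_sum_sub u S A : (forall k, 0 <= u k) -> S \subset A ->
  \sum_(k in S) u k <= \sum_(k in A) u k.
Proof.
move=> u0 /subsetP SA; rewrite !(big_mkcond (fun k => k \in _)) /=.
apply: ler_sum => k _; case: ifP => [/SA ->//|_]; by case: ifP.
Qed.

Lemma sum_setID u S A :
  \sum_(k in S) u k = \sum_(k in S :&: A) u k + \sum_(k in S :\: A) u k.
Proof. exact: big_setID. Qed.

End SetSums.

(** * Realizable demand vectors and clinching in aggregated form *)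

Section Aggregation.
Variables (R : realType) (E N : finType) (pi : E -> N).
Variable f : {set E} -> R.
Hypothesis f0 : f set0 = 0.
Hypothesis fsubmod : forall F G, f (F :|: G) + f (F :&: G) <= f F + f G.

Implicit Types (w y xi : E -> R) (u v : N -> R) (S : {set N}) (F : {set E}).

Definition fib S : {set E} := [set e | pi e \in S].

Lemma sum_fib y S : \sum_(e in fib S) y e = \sum_(k in S) \sum_(e in fib [set k]) y e.
Proof.
rewrite (partition_big pi (mem S)) /= => [|e]; last by rewrite inE.
apply: eq_bigr => k kS; apply: eq_bigl => e; rewrite !inE.
by case: eqP => [->|]; rewrite ?kS ?andbF.
Qed.

(** [F] ranges over all supersets of [fib S], since [f F] minus the [w]-amount of [F] need not be
    monotone in [F]. *)
Definition agg w u := (forall k, 0 <= u k) /\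
  forall S F, fib S \subset F ->
    \sum_(k in S) u k + \sum_(e in F) w e <= f F.

(** [U] holds the edges whose amounts are still open. The induction fixes one edge of [U] at the
    smallest amount the constraints allow and moves that amount from [u] to [w]. *)
Lemma disaggregate_unassigned (U : {set E}) w u : (forall k, 0 <= u k) ->
  (forall S F, fib S :&: U \subset F ->
     \sum_(k in S) u k + \sum_(e in F) w e <= f F) ->
  exists y, [/\ forall e, 0 <= y e,
    forall F, \sum_(e in F) (w e + y e) <= f F &
    forall k, \sum_(e in fib [set k]) y e = u k].
Proof.
have [n] := ubnP #|U|; elim: n U w u => // n IH U w u Un u0 hu.
have [U0|[e0 e0U]] := set_0Vmem U.
  exists (fun _ => 0); split => // [F|k].
    under eq_bigr do rewrite addr0.
    have := hu set0 F; rewrite big_set0 add0r; apply.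
    by rewrite U0 setI0 sub0set.
  rewrite big1 //; apply/eqP; rewrite eq_le u0 /=.
  have := hu [set k] set0; rewrite big_set1 big_set0 addr0 f0; apply.
  by rewrite U0 setI0 sub0set.
set k0 := pi e0.
pose lower (p : {set N} * {set E}) :=
  [&& k0 \in p.1, e0 \notin p.2 & fib p.1 :&: (U :\ e0) \subset p.2].
pose val (p : {set N} * {set E}) :=
  \sum_(k in p.1) u k + \sum_(e in p.2) w e - f p.2.
(* The lower bounds on the amount of [e0] come from the constraints that involve its owner [k0] but
   miss [e0]; the default [0] is nonnegativity. *)
pose a := \big[Num.max/0]_(p | lower p) val p.
have a0 : 0 <= a by exact: bigmax_ge_id.
have a_ge p : lower p -> val p <= a by exact: le_bigmax_cond.
have subU S F : fib S :&: (U :\ e0) \subset F -> (e0 \in F) || (k0 \notin S) ->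
    fib S :&: U \subset F.
  move=> /subsetP SF h; apply/subsetP => e; rewrite !inE => /andP[eS eU].
  have [ee0|ne0] := eqVneq e e0; last by apply: SF; rewrite !inE eS eU ne0.
  by move: eS h; rewrite ee0 => ->; rewrite orbF.
have a_le_u : a <= u k0.
  apply: bigmax_le => // p /and3P[kp ep sp]; rewrite /val.
  rewrite (big_setD1 k0 kp) /=.
  suff: \sum_(k in p.1 :\ k0) u k + \sum_(e in p.2) w e <= f p.2 by lra.
  apply: hu; apply: subU; last by rewrite !inE eqxx orbT.
  apply: subset_trans sp; apply: setSI; apply/subsetP => e; rewrite !inE.
  by case/andP.
(* Uncrossing keeps the lower bounds below the upper ones: the intersection avoids [k0] and the
   union contains [e0], so [hu] covers both. *)
have a_le S F : k0 \notin S -> e0 \in F -> fib S :&: (U :\ e0) \subset F ->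
    a <= f F - \sum_(k in S) u k - \sum_(e in F) w e.
  move=> kS eF SF; apply: bigmax_le => [|p /and3P[kp ep sp]].
    by have := hu S F (subU _ _ SF _); rewrite eF => /(_ isT); lra.
  rewrite /val; have := fsubmod p.2 F.
  have := sum_setUI u p.1 S; have := sum_setUI w p.2 F.
  have hI : \sum_(k in p.1 :&: S) u k + \sum_(e in p.2 :&: F) w e <= f (p.2 :&: F).
    apply: hu; apply: subU; last by rewrite !inE (negPf kS) andbF orbT.
    apply/subsetP => e; rewrite !inE => /andP[/andP[e1 e2] eU].
    by rewrite (subsetP sp) ?(subsetP SF) // !inE ?e1 ?e2 eU.
  have hU : \sum_(k in p.1 :|: S) u k + \sum_(e in p.2 :|: F) w e <= f (p.2 :|: F).
    apply: hu; apply: subU; last by rewrite !inE eF orbT.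
    apply/subsetP => e; rewrite !inE => /andP[/orP[e1|e1] eU]; apply/orP.
      by left; rewrite (subsetP sp) // !inE e1 eU.
    by right; rewrite (subsetP SF) // !inE e1 eU.
  lra.
have [|||y [y0 yF yk]] := IH (U :\ e0) (fun e => w e + if e == e0 then a else 0)
  (fun k => u k - if k == k0 then a else 0).
- by move: Un; rewrite (cardsD1 e0) e0U.
- by move=> k; case: eqP => [->|]; rewrite ?subr0 ?subr_ge0.
- move=> S F SF; rewrite sumrB big_split /= !sum_delta.
  case: ifP => kS; case: ifP => eF.
  + by have := hu S F (subU _ _ SF _); rewrite eF => /(_ isT); lra.
  + by have := a_ge (S, F); rewrite /lower /val /= kS eF SF => /(_ isT); lra.
  + by have := a_le S F; rewrite kS eF => /(_ isT isT SF); lra.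
  + by have := hu S F (subU _ _ SF _); rewrite kS orbT => /(_ isT); lra.
exists (fun e => y e + if e == e0 then a else 0); split => [e|F|k].
- by rewrite addr_ge0 //; case: ifP.
- by apply: le_trans (yF F); apply: ler_sum => e _; lra.
rewrite big_split /= yk sum_delta !inE [k == _]eq_sym -/k0; by case: ifP; lra.
Qed.

Lemma aggP w u : agg w u <-> exists y, [/\ forall e, 0 <= y e,
    forall F, \sum_(e in F) (w e + y e) <= f F &
    forall k, \sum_(e in fib [set k]) y e = u k].
Proof.
split=> [[u0 hu]|[y [y0 yF yk]]].
  apply: (@disaggregate_unassigned setT) => // S F; rewrite setIT; exact: hu.
split=> [k|S F SF]; first by rewrite -yk sumr_ge0.
apply: le_trans (yF F); rewrite big_split /= addrC; apply: lerD => //.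
under eq_bigr do rewrite -yk.
by rewrite -sum_fib; apply: ler_sum_sub.
Qed.

Lemma agg_ext w w' u : w =1 w' -> agg w u -> agg w' u.
Proof.
move=> ww' [u0 hu]; split=> // S F /hu; congr (_ + _ <= _).
by apply: eq_bigr => e _; rewrite ww'.
Qed.

Lemma agg_le w w' u u' : agg w u -> (forall e, w' e <= w e) ->
  (forall k, 0 <= u' k) -> (forall k, u' k <= u k) -> agg w' u'.
Proof.
move=> [u0 hu] ww' u'0 uu'; split=> // S F /hu; apply: le_trans.
by apply: lerD; apply: ler_sum.
Qed.

Lemma le_demW (a b : R) d : a <= b -> le_dem b d -> le_dem a d.
Proof. by case: d => //= c; apply: le_trans. Qed.

Definition dem_agg w (d : N -> option R) u := agg w u /\ forall k, le_dem (u k) (d k).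

Lemma dem_agg_le w d u u' : dem_agg w d u -> (forall k, 0 <= u' k) ->
  (forall k, u' k <= u k) -> dem_agg w d u'.
Proof.
move=> [gu ud] u'0 uu'; split=> [|k]; first exact: agg_le gu _ u'0 uu'.
exact: le_demW (ud k).
Qed.

(** Only vectors with [u i = 0] are tested because [P^i] ignores coordinate [i]; the inclusion of
    [P^i(xi)] in [P^i(0)] is automatic. *)
Definition eclinch w (d : N -> option R) i xi :=
  [/\ forall e, pi e != i -> xi e = 0, forall e, 0 <= xi e,
      le_dem (\sum_(e in fib [set i]) xi e) (d i) &
      forall u, dem_agg w d u -> u i = 0 -> agg (fun e => w e + xi e) u].

Definition no_eclinch w d i := forall xi, eclinch w d i xi -> forall e, xi e = 0.

Definition shift_at (i : N) (a : R) u k := u k + if k == i then a else 0.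

Lemma sum_shift_at i a u S :
  \sum_(k in S) shift_at i a u k = \sum_(k in S) u k + if i \in S then a else 0.
Proof. by rewrite big_split /= sum_delta. Qed.

Lemma sum_supp_fib i xi F : (forall e, pi e != i -> xi e = 0) ->
  fib [set i] \subset F -> \sum_(e in F) xi e = \sum_(e in fib [set i]) xi e.
Proof.
move=> xi0 /subsetP iF; rewrite (big_setID (fib [set i])) /= [X in _ + X]big1 => [|e].
  rewrite addr0; apply: eq_bigl => e; rewrite !inE andbC.
  by case: eqP => //= ei; rewrite iF // !inE ei.
by rewrite !inE => /andP[/xi0].
Qed.

Lemma agg_unclinch w xi i u : (forall e, pi e != i -> xi e = 0) ->
  (forall e, 0 <= xi e) -> agg (fun e => w e + xi e) u ->
  agg w (shift_at i (\sum_(e in fib [set i]) xi e) u).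
Proof.
move=> xi0 xp [u0 hu]; split=> [k|S F SF].
  by rewrite addr_ge0 //; case: ifP => // _; rewrite sumr_ge0.
have := hu S F SF; rewrite big_split /= sum_shift_at; case: ifP => iS.
  rewrite (sum_supp_fib xi0 (F := F)); first lra.
  apply: subset_trans SF; apply/subsetP => e; rewrite !inE => /eqP ->; exact: iS.
have : 0 <= \sum_(e in F) xi e by exact: sumr_ge0.
lra.
Qed.

(** For [i] in [S] the constraint is that of the shifted vector. For [i] outside [S] it does not see
    [u i], which may be set to [0] so that the clinching condition applies. *)
Lemma eclinch_agg w d i xi u : eclinch w d i xi -> (forall k, 0 <= u k) ->
  dem_agg w d (shift_at i (\sum_(e in fib [set i]) xi e) u) ->
  agg (fun e => w e + xi e) u.
Proof.
move=> [xi0 xp xd hxi] u0 Du; split=> // S F SF.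
have d0 : 0 <= \sum_(e in fib [set i]) xi e by exact: sumr_ge0.
have [iS|iS] := boolP (i \in S).
  have [_ /(_ S F SF)] := Du.1; rewrite sum_shift_at iS big_split /=.
  rewrite (sum_supp_fib xi0 (F := F)); first lra.
  apply: subset_trans SF; apply/subsetP => e; rewrite !inE => /eqP ->; exact: iS.
have := hxi (fun k => if k == i then 0 else u k); rewrite eqxx => hx.
have [|//|_ /(_ S F SF)] := hx.
  apply: dem_agg_le Du _ _ => k; first by case: ifP.
  by rewrite /shift_at; case: ifP => _; rewrite ?addr0 // addr_ge0.
congr (_ + _ <= _); apply: eq_bigr => k kS; case: eqP kS iS => // -> ->//.
Qed.

(** Phrased through upper bounds, so that infinite demands need no subtraction. *)
Definition dem_step (d d' : N -> option R) i (a : R) := forall k b,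
  le_dem b (d' k) <-> le_dem (b + if k == i then a else 0) (d k).

Lemma dem_stepW d d' i a k b : 0 <= a -> dem_step d d' i a ->
  le_dem b (d' k) -> le_dem b (d k).
Proof.
move=> a0 dd' /dd'; apply: le_demW; case: ifP => _; by rewrite ?addr0 // lerDl.
Qed.

Lemma dem_step_zero w d d' i xi k : eclinch w d i xi ->
  dem_step d d' i (\sum_(e in fib [set i]) xi e) -> d k = Some 0 -> d' k = Some 0.
Proof.
move=> [_ xp xd _] dd' dk; set a := \sum_(e in _) _ in xd dd'.
have a0 : 0 <= a by exact: sumr_ge0.
have {}dd' b : le_dem b (d' k) <-> b <= 0.
  rewrite dd' dk /=; case: eqP => [ki|_]; last by rewrite addr0.
  move: xd; rewrite -ki dk /= => xd; have a00 : a = 0 by apply/eqP; rewrite eq_le xd.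
  by rewrite a00 addr0.
move: dd'; case: (d' k) => /= [c|] h.
  have := (h c).1 (lexx c); have := (h 0).2 (lexx 0) => h1 h2.
  by congr Some; apply/eqP; rewrite eq_le h1 h2.
by have := (h 1).1 I; rewrite ler10.
Qed.

(** The truncation at [0] covers vectors giving [i] less than the clinched amount. *)
Definition after_clinch (i : N) (a : R) u k :=
  if k == i then Num.max 0 (u k - a) else u k.

Lemma dem_agg_after w d d' i xi u : eclinch w d i xi ->
  dem_step d d' i (\sum_(e in fib [set i]) xi e) -> dem_agg w d u ->
  dem_agg (fun e => w e + xi e) d'
    (after_clinch i (\sum_(e in fib [set i]) xi e) u).
Proof.
move=> cl dd' Du; set a := \sum_(e in _) _.
have [xi0 xp xd hxi] := cl.
have a0 : 0 <= a by exact: sumr_ge0.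
have u0 := Du.1.1.
have v0 k : 0 <= after_clinch i a u k.
  by rewrite /after_clinch; case: ifP => // _; rewrite le_max lexx.
split=> [|k]; last first.
  apply/dd'; rewrite -/a /after_clinch; case: eqP => [->|_]; last first.
    by rewrite addr0; exact: Du.2.
  have [h|h] := leP 0 (u i - a); first by rewrite subrK; exact: Du.2.
  by rewrite add0r.
have [ai|ai] := leP a (u i).
  apply: (eclinch_agg cl) => //; apply: dem_agg_le Du _ _ => k.
    by rewrite addr_ge0 //; case: ifP.
  rewrite /shift_at /after_clinch -/a; case: eqP => [->|_]; last by rewrite addr0.
  by rewrite max_r ?subr_ge0 // subrK.
have ei : after_clinch i a u i = 0.
  by rewrite /after_clinch eqxx max_l // subr_le0 ltW.
apply: hxi => //; apply: dem_agg_le Du v0 _ => k.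
by have [->|ki] := eqVneq k i; rewrite ?ei // /after_clinch (negPf ki).
Qed.

(** If [k] could clinch [z] afterwards, take [u] in the old set, apply the clinch of [i], then [z],
    then refund [xi]. The result dominates [u], so [z] was clinchable before. *)
Lemma no_eclinch_other w d d' i k xi : eclinch w d i xi ->
  dem_step d d' i (\sum_(e in fib [set i]) xi e) -> k != i ->
  no_eclinch w d k -> no_eclinch (fun e => w e + xi e) d' k.
Proof.
move=> cl dd' ki nok z [z0 zp zd hz]; apply: nok; split=> //.
  by move/dd': zd; rewrite (negPf ki) addr0.
have [xi0 xp xd _] := cl => u Du uk.
have Dv := dem_agg_after cl dd' Du.
have := hz _ Dv; rewrite /after_clinch (negPf ki) => /(_ uk) gv.
have {}gv : agg (fun e => w e + z e + xi e)
  (after_clinch i (\sum_(e in fib [set i]) xi e) u).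
  by apply: agg_ext gv => e /=; rewrite addrAC.
apply: agg_le (agg_unclinch xi0 xp gv) _ Du.1.1 _ => // m.
rewrite /shift_at /after_clinch; case: eqP => _; last by rewrite addr0.
by rewrite -lerBlDr le_max lexx orbT.
Qed.

(** A further clinch [z] could be added to [xi], against maximality. *)
Lemma no_eclinch_own w d d' i xi : eclinch w d i xi ->
  (forall xi', eclinch w d i xi' -> (forall e, xi e <= xi' e) -> xi' =1 xi) ->
  dem_step d d' i (\sum_(e in fib [set i]) xi e) ->
  no_eclinch (fun e => w e + xi e) d' i.
Proof.
move=> [xi0 xp xd hxi] xmax dd' z [z0 zp zd hz] e.
suff /xmax/(_ _ e) : eclinch w d i (fun e => xi e + z e).
  by move=> h; apply: (addrI (xi e)); rewrite h ?addr0 // => e'; rewrite lerDl.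
split=> [e' ei|e'||u Du ui].
- by rewrite xi0 // z0 // addr0.
- exact: addr_ge0.
- by rewrite big_split /= addrC; move/dd': zd; rewrite eqxx.
have gu := hxi u Du ui.
have /hz : dem_agg (fun e => w e + xi e) d' u.
  split=> // k; apply/dd'; case: eqP => [->|_]; first by rewrite ui add0r.
  by rewrite addr0; exact: Du.2.
by move=> /(_ ui); apply: agg_ext => e'; rewrite addrA.
Qed.

(* Taking back everything the agents of [K] have clinched does not enlarge what
   the other agents can still obtain. *)
Definition refund_inv w (d : N -> option R) := forall (K : {set N}) u,
  agg (fun e => if pi e \in K then 0 else w e) u ->
  (forall k, k \in K -> u k = 0) -> (forall k, le_dem (u k) (d k)) -> agg w u.

Lemma refund_inv_dem w d d' : refund_inv w d ->
  (forall k b, 0 <= b -> le_dem b (d' k) -> le_dem b (d k)) -> refund_inv w d'.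
Proof.
move=> J dd' K u gu uK ud; apply: (J K) => // k.
by apply: dd' (ud k); exact: gu.1.
Qed.

(** If [i] is in [K], its new clinch is refunded as well and the old invariant applies to [u].
    Otherwise it applies to [u] shifted by the clinched amount, and the clinch is then redone. *)
Lemma refund_inv_clinch w d d' i xi : eclinch w d i xi ->
  dem_step d d' i (\sum_(e in fib [set i]) xi e) ->
  refund_inv w d -> refund_inv (fun e => w e + xi e) d'.
Proof.
move=> cl dd' J K u gu uK ud; have [xi0 xp xd hxi] := cl.
set a := \sum_(e in _) _ in dd'; have a0 : 0 <= a by exact: sumr_ge0.
have [iK|iK] := boolP (i \in K).
  have ud' k : le_dem (u k) (d k) by apply: dem_stepW dd' (ud k).
  apply: hxi; last exact: uK.
  split=> //; apply: (J K) => //; apply: agg_ext gu => e /=.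
  case: ifP => // eK; rewrite xi0 ?addr0 //; apply: contraFneq eK => -> //.
apply: (eclinch_agg cl); first exact: gu.1.
have Dsh k : le_dem (shift_at i a u k) (d k) by apply/dd'.
split=> //; apply: (J K) => // [|k kK]; last first.
  rewrite /shift_at uK // add0r; case: eqP kK iK => // -> ->//.
apply: agg_unclinch => //; apply: agg_ext gu => e /=.
case: ifP => // eK; rewrite xi0 ?addr0 //.
by apply: contraNneq iK => <-.
Qed.

(** * Tight constraints and saturation *)

Definition tight w u (p : {set N} * {set E}) :=
  (fib p.1 \subset p.2) && (\sum_(k in p.1) u k + \sum_(e in p.2) w e == f p.2).

Lemma fibU S S' : fib (S :|: S') = fib S :|: fib S'.
Proof. by apply/setP => e; rewrite !inE. Qed.

Lemma fibI S S' : fib (S :&: S') = fib S :&: fib S'.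
Proof. by apply/setP => e; rewrite !inE. Qed.

(** By submodularity the slacks of union and intersection add up to at most the two given slacks,
    which are zero. *)
Lemma tightU w u p q : agg w u -> tight w u p -> tight w u q ->
  tight w u (p.1 :|: q.1, p.2 :|: q.2).
Proof.
move=> [_ hu] /andP[ps /eqP pt] /andP[qs /eqP qt].
rewrite /tight /= fibU setUSS //= eq_le hu ?fibU ?setUSS //=.
have := hu (p.1 :&: q.1) (p.2 :&: q.2); rewrite fibI setISS // => /(_ isT).
have := fsubmod p.2 q.2; have := sum_setUI u p.1 q.1; have := sum_setUI w p.2 q.2.
lra.
Qed.

Lemma max_tight w u : agg w u ->
  exists2 p, tight w u p & forall q, tight w u q -> q.1 \subset p.1 /\ q.2 \subset p.2.
Proof.
move=> gu.
have t0 : tight w u (set0, set0).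
  rewrite /tight /= !big_set0 f0 addr0 eqxx andbT.
  by apply/subsetP => e; rewrite !inE.
case: (arg_maxnP (fun p : {set N} * {set E} => #|p.1| + #|p.2|)%N t0) => p tp pmax.
exists p => // q tq; have := pmax _ (tightU gu tp tq) => /= le_pq.
have h1 := subset_leq_card (subsetUl p.1 q.1).
have h2 := subset_leq_card (subsetUl p.2 q.2).
have e1 : p.1 :|: q.1 = p.1.
  apply/eqP; rewrite eq_sym eqEcard subsetUl /=.
  by rewrite -(leq_add2r #|p.2|); apply: leq_trans le_pq; rewrite leq_add2l.
have e2 : p.2 :|: q.2 = p.2.
  apply/eqP; rewrite eq_sym eqEcard subsetUl /=.
  by rewrite -(leq_add2l #|p.1|); apply: leq_trans le_pq; rewrite leq_add2r.
by rewrite -e1 -e2 !subsetUr.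
Qed.

Definition saturated w (d : N -> option R) u k :=
  d k = Some (u k) \/ exists2 p, tight w u p & k \in p.1.

Lemma saturated_le w d u u' k : saturated w d u k -> dem_agg w d u' ->
  (forall m, u m <= u' m) -> saturated w d u' k.
Proof.
move=> [dk|[p /andP[ps /eqP pt] kp]] [gu' ud'] uu'; [left|right].
  rewrite dk; congr Some; apply/eqP; rewrite eq_le uu' /=.
  by have := ud' k; rewrite dk.
exists p => //; rewrite /tight ps /= eq_le gu'.2 //= -pt lerD2r.
exact: ler_sum.
Qed.

(** Coordinate [m] is raised until its demand binds or the smallest slack among the constraints
    containing [m] is used up. *)
Lemma saturate1 w d u m : dem_agg w d u -> exists u',
  [/\ dem_agg w d u', forall k, u k <= u' k, forall k, k != m -> u' k = u k &
      saturated w d u' m].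
Proof.
move=> [[u0 hu] ud].
pose P (p : {set N} * {set E}) := (m \in p.1) && (fib p.1 \subset p.2).
pose slack (p : {set N} * {set E}) :=
  f p.2 - \sum_(k in p.1) u k - \sum_(e in p.2) w e.
have P0 : P (setT, setT) by rewrite /P /= inE subsetT.
case: (@Order.TotalTheory.arg_minP _ _ _ (setT, setT) P slack P0) => p Pp pmin.
have [mp sp] := andP Pp.
have t0 : 0 <= slack p by have := hu p.1 p.2 sp; rewrite /slack; lra.
have raise t : 0 <= t -> t <= slack p -> le_dem (u m + t) (d m) ->
    dem_agg w d (shift_at m t u).
  move=> tp tle td; split=> [|k]; last first.
    by rewrite /shift_at; case: eqP => [->|_] //; rewrite addr0.
  split=> [k|S F SF]; first by rewrite addr_ge0 //; case: ifP.
  rewrite sum_shift_at; have := hu S F SF; case: ifP => mS; last lra.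
  by have := pmin (S, F); rewrite /P /= mS SF => /(_ isT); rewrite {2}/slack /=; lra.
have shift_ge t k : 0 <= t -> u k <= shift_at m t u k.
  by move=> tp; rewrite lerDl; case: ifP.
have shift_id t k : k != m -> shift_at m t u k = u k.
  by move=> /negPf km; rewrite /shift_at km addr0.
have [[b [dm hb]]|hd] : (exists b, d m = Some b /\ b < u m + slack p) \/
    le_dem (u m + slack p) (d m).
  case: (d m) => [b|]; last by right.
  by have [h|h] := ltP b (u m + slack p); [left; exists b|right].
  have ub : u m <= b by have := ud m; rewrite dm.
  exists (shift_at m (b - u m) u); split=> [|k|k|].
  - by apply: raise; rewrite ?dm //=; lra.
  - by apply: shift_ge; lra.
  - exact: shift_id.
  - by left; rewrite dm /shift_at eqxx; congr Some; lra.
exists (shift_at m (slack p) u); split=> [|k|k|].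
- exact: raise.
- exact: shift_ge.
- exact: shift_id.
- by right; exists p => //; rewrite /tight sp /= sum_shift_at mp /slack; apply/eqP; lra.
Qed.

Lemma saturate w d u (V : seq N) : dem_agg w d u -> exists u',
  [/\ dem_agg w d u', forall k, u k <= u' k, forall k, k \notin V -> u' k = u k &
      forall k, k \in V -> saturated w d u' k].
Proof.
elim: V u => [|m V IH] u Du; first by exists u; split.
have [u1 [Du1 u1u u1e s1]] := saturate1 m Du.
have [u2 [Du2 u2u u2e s2]] := IH _ Du1.
exists u2; split=> // [k|k|k]; first exact: le_trans (u2u k).
  by rewrite inE negb_or => /andP[km kV]; rewrite u2e // u1e.
by rewrite inE => /predU1P[->|/s2//]; apply: saturated_le s1 _ _.
Qed.

(** All coordinates but [k] are saturated while [u k] stays [0], and [p] is the largest tight pair.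
    If [k] has nonzero demand and an edge outside [p.2], a positive amount of that edge is
    clinchable. *)
Lemma no_eclinch_max w d k : dem_agg w d (fun _ => 0) -> no_eclinch w d k ->
  exists u, [/\ dem_agg w d u, u k = 0 &
    forall v, dem_agg w d v -> \sum_m v m <= \sum_m u m].
Proof.
move=> D0 nok.
have [u [Du _ uk usat]] := saturate (enum (predC1 k)) D0.
have {}uk : u k = 0 by apply: uk; rewrite mem_enum inE eqxx.
have {}usat m : m != k -> saturated w d u m.
  by move=> mk; apply: usat; rewrite mem_enum.
exists u; split=> //.
have [p tp pmax] := max_tight Du.1.
have [ps /eqP pt] := andP tp.
have sat_d m : m != k -> m \notin p.1 -> d m = Some (u m).
  by move=> mk mp; case: (usat m mk) => // -[q /pmax[/subsetP/(_ m) h _] /h];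
    rewrite (negPf mp).
have split_sum v : \sum_m v m = \sum_(m in k |: p.1) v m + \sum_(m in ~: (k |: p.1)) v m.
  rewrite (bigID (mem (k |: p.1))) /=; congr (_ + _).
  by apply: eq_bigl => m; rewrite !inE.
have out v : dem_agg w d v ->
    \sum_(m in ~: (k |: p.1)) v m <= \sum_(m in ~: (k |: p.1)) u m.
  move=> [_ vd]; apply: ler_sum => m; rewrite !inE negb_or => /andP[mk mp].
  by have := vd m; rewrite sat_d.
have ukp : \sum_(m in p.1) u m <= \sum_(m in k |: p.1) u m.
  by apply: ler_sum_sub; [exact: Du.1.1 | exact: subsetUr].
(* When [p.2] covers the edges of [k], the agent [k] may join [p.1] under the same bound, so no
   vector gains from [k]. *)
have [kF v Dv|/subsetPn[e]] := boolP (fib [set k] \subset p.2).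
  rewrite !split_sum; apply: lerD (out v Dv).
  have := Dv.1.2 (k |: p.1) p.2; rewrite fibU subUset kF ps => /(_ isT).
  by move: pt ukp; lra.
rewrite !inE => /eqP ek ep.
case dk : (d k == Some 0).
  move=> v Dv; rewrite !split_sum; apply: lerD (out v Dv).
  have := Dv.1.2 p.1 p.2 ps; have vk := Dv.2 k; rewrite (eqP dk) /= in vk.
  have : \sum_(m in k |: p.1) v m <= \sum_(m in p.1) v m.
    rewrite -[leRHS]addr0; have := sum_setUI v [set k] p.1; rewrite big_set1.
    have : 0 <= \sum_(m in [set k] :&: p.1) v m by apply: sumr_ge0 => m _; exact: Dv.1.1.
    lra.
  by move: pt ukp; lra.
pose P (q : {set N} * {set E}) := (e \in q.2) && (fib q.1 \subset q.2).
pose slack (q : {set N} * {set E}) :=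
  f q.2 - \sum_(m in q.1) u m - \sum_(e in q.2) w e.
have P0 : P (setT, setT) by rewrite /P /= inE subsetT.
case: (@Order.TotalTheory.arg_minP _ _ _ (setT, setT) P slack P0) => q /andP[eq sq] qmin.
(* A zero slack would put [e] into the largest tight pair. *)
have slack0 : 0 < slack q.
  have := Du.1.2 q.1 q.2 sq; rewrite /slack le_eqVlt => /predU1P[qt|]; last lra.
  suff /pmax[_ /subsetP/(_ e eq)] : tight w u q by rewrite (negPf ep).
  by rewrite /tight sq qt eqxx.
have [t [t0 tq td]] : exists t, [/\ 0 < t, t <= slack q & le_dem t (d k)].
  move: (D0.2 k) dk; case: (d k) => [b|] /= b0 dk; last by exists (slack q).
  exists (Num.min (slack q) b); rewrite ge_min lexx /= lt_min slack0 /=.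
  rewrite ge_min lexx orbT; split=> //; rewrite lt_neqAle b0 andbT.
  by apply/eqP => b00; rewrite -b00 eqxx in dk.
have /nok/(_ e) : eclinch w d k (fun e' => if e' == e then t else 0).
  split=> [e' ek'|e'||v Dv vk].
  - by case: (e' =P e) ek' => // ->; rewrite ek eqxx.
  - by case: ifP => // _; exact: ltW.
  - by rewrite sum_delta !inE ek eqxx.
  split=> [|S F SF]; first exact: Dv.1.1.
  rewrite big_split /= sum_delta; have := Dv.1.2 S F SF.
  case: ifP => [eF _|]; last lra.
  (* The pair [(S, F)] is uncrossed with [p]: the union contains [e], so it has slack at least [t]
     for [u], and outside [p.1] the vector [v] cannot exceed [u]. *)
  have hSp : \sum_(m in S :\: p.1) v m <= \sum_(m in S :\: p.1) u m.
    apply: ler_sum => m; rewrite inE => /andP[mp _].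
    have [->|mk] := eqVneq m k; first by rewrite uk vk.
    by have := Dv.2 m; rewrite sat_d.
  have hI := Dv.1.2 (S :&: p.1) (F :&: p.2).
  rewrite fibI setISS // in hI; have {}hI := hI isT.
  have := qmin (S :|: p.1, F :|: p.2).
  rewrite /P /= inE eF fibU setUSS //= => /(_ isT); rewrite {2}/slack /=.
  have := fsubmod F p.2; have := sum_setUI w F p.2; have := sum_setUI u S p.1.
  have := sum_setID u S p.1; have := sum_setID v S p.1.
  move: pt; lra.
by rewrite eqxx => t00; rewrite t00 ltxx in t0.
Qed.

(* Everything still unsold on the edges of [A] can be absorbed by the demands of [A]. *)
Definition reserved (A : {set N}) w (d : N -> option R) :=
  (forall k, k \notin A -> d k = Some 0) /\
  exists2 u, dem_agg w d u &
    f (fib A) <= \sum_(k in A) u k + \sum_(e in fib A) w e.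

(** What the witness loses at [i] is at most what [xi] adds to the edges of [i]. *)
Lemma reserved_clinch A w d d' i xi : eclinch w d i xi ->
  dem_step d d' i (\sum_(e in fib [set i]) xi e) ->
  reserved A w d -> reserved A (fun e => w e + xi e) d'.
Proof.
move=> cl dd' [dA [u Du uA]]; split=> [k /dA|]; first exact: (dem_step_zero cl dd').
exists (after_clinch i (\sum_(e in fib [set i]) xi e) u).
  exact: (dem_agg_after cl dd' Du).
have [xi0 xp _ _] := cl.
set a := \sum_(e in fib [set i]) _; apply: le_trans uA _; rewrite big_split /=.
have xiA : (if i \in A then a else 0) <= \sum_(e in fib A) xi e.
  case: ifP => iA; last exact: sumr_ge0.
  rewrite (sum_supp_fib xi0 (F := fib A)) //; apply/subsetP => e.
  by rewrite !inE => /eqP ->.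
have uA : \sum_(k in A) u k <=
    \sum_(k in A) after_clinch i a u k + if i \in A then a else 0.
  rewrite -sum_delta -big_split /=; apply: ler_sum => k _.
  rewrite /after_clinch; case: ifP => _; last by rewrite addr0.
  by rewrite -lerBlDr le_max lexx orbT.
lra.
Qed.

Lemma sum_demand0 (A : {set N}) u d : (forall k, 0 <= u k) -> (forall k, le_dem (u k) (d k)) ->
  (forall k, k \notin A -> d k = Some 0) -> \sum_(k in A) u k = \sum_k u k.
Proof.
move=> u0 ud dA; rewrite big_mkcond /=; apply: eq_bigr => k _; case: ifPn => // /dA dk.
by apply/eqP; rewrite eq_le u0 /=; have := ud k; rewrite dk.
Qed.

(** As [l] cannot clinch, some maximizer gives [l] nothing and is unaffected by the change of its
    demand. Demands off [A] vanish, so totals over [A] and over all agents agree. *)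
Lemma reserved_price A w d d' l : dem_agg w d (fun _ => 0) -> no_eclinch w d l ->
  (forall k, k != l -> d' k = d k) -> le_dem 0 (d' l) ->
  (d l = Some 0 -> d' l = Some 0) -> reserved A w d -> reserved A w d'.
Proof.
move=> D0 nol dd' dl0 dl00 [dA [u Du uA]]; split=> [k /dA|].
  by have [->|kl] := eqVneq k l; [exact: dl00 | rewrite dd'].
have [v [Dv vl vmax]] := no_eclinch_max D0 nol.
exists v.
  split=> [|k]; first exact: Dv.1.
  have [->|kl] := eqVneq k l; first by rewrite vl.
  by rewrite dd' //; exact: Dv.2.
apply: le_trans uA _; rewrite lerD2r.
rewrite (sum_demand0 Du.1.1 Du.2 dA) (sum_demand0 Dv.1.1 Dv.2 dA); exact: vmax.
Qed.

Hypothesis fmono : forall F G : {set E}, F \subset G -> f F <= f G.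

Lemma reserved_active w d : dem_agg w d (fun _ => 0) -> (forall e, 0 <= w e) ->
  refund_inv w d -> (forall k, no_eclinch w d k) ->
  reserved [set k | d k != Some 0] w d.
Proof.
move=> D0 w0 J noc; set A := [set k | _].
have dA k : k \notin A -> d k = Some 0 by rewrite inE negbK => /eqP.
split=> //.
(* Refunding the agents outside [A] makes [w1] vanish off [fib A]; [J] brings vectors realizable
   over [w1] back to [w]. *)
pose w1 e := if pi e \in ~: A then 0 else w e.
have w1w e : w1 e <= w e by rewrite /w1; case: ifP.
have sub u : dem_agg w d u -> dem_agg w1 d u.
  by move=> [gu ud]; split=> //; apply: (agg_le gu) => //; case: gu.
have [u [Du _ _ usat]] := saturate (enum N) (sub _ D0).
have {}usat k : saturated w1 d u k by apply: usat; rewrite mem_enum.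
have Dwu : dem_agg w d u.
  split; last exact: Du.2.
  apply: (J (~: A)) => // [|k|]; [exact: Du.1| |exact: Du.2].
  rewrite inE => /dA dk; apply/eqP; rewrite eq_le Du.1.1 andbT.
  by have := Du.2 k; rewrite dk.
exists u => //.
have [p tp pmax] := max_tight Du.1.
have [ps /eqP pt] := andP tp.
have sat_d m : m \notin p.1 -> d m = Some (u m).
  move=> mp; case: (usat m) => // -[q /pmax[/subsetP/(_ m) h _] /h].
  by rewrite (negPf mp).
(* An agent [k] of [A] outside [p.1] would have [u k] equal to its positive demand. A maximizer with
   [v k = 0] cannot beat [u] on [p.1] or on the other coordinates, so its total would be too
   small. *)
have Ap : A \subset p.1.
  apply/subsetP => k kA; apply/negP => /negP kp.
  have [v [Dv vk vmax]] := no_eclinch_max D0 (noc k).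
  have := vmax _ Dwu.
  have uk : 0 < u k.
    rewrite lt_neqAle Du.1.1 andbT; apply/eqP => uk.
    by move: kA; rewrite inE sat_d // -uk eqxx.
  rewrite !(bigID (mem p.1) predT) /=.
  rewrite !(bigD1 (P := fun m => m \notin p.1) k kp) /= vk.
  have : \sum_(m | (m \notin p.1) && (m != k)) v m <=
      \sum_(m | (m \notin p.1) && (m != k)) u m.
    by apply: ler_sum => m /andP[mp _]; have := Dv.2 m; rewrite sat_d.
  have := (sub _ Dv).1.2 p.1 p.2 ps; move: pt uk; lra.
have Fp : fib A \subset p.2.
  by apply: subset_trans ps; apply/subsetP => e; have := subsetP Ap (pi e); rewrite !inE.
apply: le_trans (fmono Fp) _; rewrite -pt; apply: lerD.
  rewrite (sum_demand0 Du.1.1 Du.2 dA) (sum_demand0 Du.1.1 Du.2 (A := p.1)) //.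
  by move=> k kp; apply: dA; apply: contraNN kp => /(subsetP Ap).
rewrite [leRHS]big_mkcond [leLHS]big_mkcond /=; apply: ler_sum => e _.
by rewrite /w1 !inE; case: (d (pi e) == Some 0); case: (e \in p.2) => /=.
Qed.

End Aggregation.

(** * Comparing weighted sums through upper level sets *)

Section WeightedDominance.
Variables (R : realFieldType) (N : finType) (v : N -> R).

Lemma weighted_sum_ge0 (y : N -> R) : (forall k, 0 <= v k) ->
  (forall t, 0 <= \sum_(k in [set k | t <= v k]) y k) -> 0 <= \sum_k v k * y k.
Proof.
move=> v0 y0.
(* Generalizing to upper sets [A] and a base level [c] lets the induction strip the lowest level of
   [A] and restart from its value. *)
suff H (A : {set N}) c : (forall k m, k \in A -> v k <= v m -> m \in A) ->
    (forall k, k \in A -> c <= v k) -> 0 <= \sum_(k in A) (v k - c) * y k.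
  have := H setT 0; under eq_bigl do rewrite inE; under eq_bigr do rewrite subr0.
  by apply => k *; rewrite ?inE.
have [n] := ubnP #|A|; elim: n A c => // n IH A c An Aup Ac.
have [A0|[k0 k0A]] := set_0Vmem A; first by rewrite A0 big_set0.
case: (@Order.TotalTheory.arg_minP _ _ _ k0 (mem A) v k0A) => k1 k1A k1min.
have AE : A = [set k | v k1 <= v k].
  apply/setP => k; rewrite inE; apply/idP/idP => [/k1min //|]; exact: Aup.
have -> : \sum_(k in A) (v k - c) * y k = (v k1 - c) * (\sum_(k in A) y k) +
    \sum_(k in [set k in A | v k1 < v k]) (v k - v k1) * y k.
  rewrite mulr_sumr.
  have -> : \sum_(k in [set k in A | v k1 < v k]) (v k - v k1) * y k =
      \sum_(k in A) (v k - v k1) * y k.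
    rewrite big_mkcond [RHS]big_mkcond; apply: eq_bigr => k _; rewrite inE.
    case: (boolP (k \in A)) => //= kA; case: (ltP (v k1) (v k)) => // vk.
    have -> : v k = v k1 by apply/eqP; rewrite eq_le vk k1min.
    by rewrite subrr mul0r.
  by rewrite -big_split /=; apply: eq_bigr => k _; ring.
rewrite addr_ge0 //; first by rewrite mulr_ge0 ?subr_ge0 ?Ac // AE.
apply: IH => [|k m|k]; last by rewrite inE => /andP[_ /ltW].
  rewrite ltnS in An; apply: leq_trans An; apply: proper_card; apply/properP; split.
    by apply/subsetP => k; rewrite inE => /andP[].
  by exists k1 => //; rewrite inE ltxx andbF.
rewrite !inE => /andP[kA k1k] km; rewrite (Aup k) //=; exact: lt_le_trans km.
Qed.

Variable g : {set N} -> R.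
Hypothesis g0 : g set0 = 0.
Hypothesis gsubmod : forall S T, g (S :|: T) + g (S :&: T) <= g S + g T.

(** At each threshold, tight sets within the level set have a largest member [T]. On [T] the bound
    [g T] separates the two sums; off [T] only [z l <= x l] is possible, since a tight set for [l]
    would lie inside [T]. *)
Lemma tight_dominance (z x : N -> R) : (forall k, 0 <= v k) ->
  (forall S : {set N}, \sum_(k in S) z k <= g S) ->
  (forall S : {set N}, \sum_(k in S) x k <= g S) ->
  (forall l, z l <= x l \/ exists T : {set N}, [/\ l \in T,
     forall k, k \in T -> v l <= v k & g T <= \sum_(k in T) x k]) ->
  \sum_k v k * z k <= \sum_k v k * x k.
Proof.
move=> v0 zg xg zx; rewrite -subr_ge0 -sumrB.
under eq_bigr do rewrite -mulrBr.
apply: weighted_sum_ge0 => // t; set A := [set k | _].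
pose P (T : {set N}) := (T \subset A) && (g T <= \sum_(k in T) x k).
have P0 : P set0 by rewrite /P sub0set big_set0 g0 lexx.
case: (arg_maxnP (fun T : {set N} => #|T|) P0) => T /andP[TA Tt] Tmax.
have Ttop S : P S -> S \subset T.
  move=> /andP[SA St]; suff /Tmax h : P (T :|: S).
    have /eqP -> : T == T :|: S by rewrite eqEcard subsetUl.
    exact: subsetUr.
  rewrite /P subUset TA SA /=.
  by have := gsubmod T S; have := sum_setUI x T S; have := xg (T :&: S); lra.
rewrite sumrB subr_ge0 (sum_setID z A T) (sum_setID x A T).
have -> : A :&: T = T by apply/setIidPr.
apply: lerD; first exact: le_trans (zg T) Tt.
apply: ler_sum => l; rewrite !inE => /andP[lT tl].
case: (zx l) => // -[S [lS Sv St]]; move: lT; rewrite (subsetP (Ttop S _)) //.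
rewrite /P St andbT; apply/subsetP => k /Sv; rewrite inE; exact: le_trans.
Qed.
End WeightedDominance.

(** * The modified market as a single submodular function *)

Section Market.
Variables (R : realType) (M : market R).
Hypothesis wf : market_wf M.
Implicit Types (F G : {set edge M}) (S : {set agent M}) (w y : edge M -> R).

Local Notation fibM := (@fib (edge M) (agent M) fst).

Lemma orig_sub j F : F \subset Ej j -> orig F \subset E0j j.
Proof.
move=> /subsetP FE; apply/subsetP => -[i j'] /=; rewrite !inE /= => /FE.
by rewrite !inE /Defs.inE /= (unsplitK (inl i)).
Qed.

Lemma origS F G : F \subset G -> orig F \subset orig G.
Proof. by move=> /subsetP FG; apply/subsetP => e; rewrite !inE => /FG. Qed.

Lemma fmod0 (j : 'I_(nS M)) : fmod j (set0 : {set edge M}) = 0.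
Proof.
have [_ [_ [_ /(_ j)[f0 _]]]] := wf.
rewrite /fmod inE -f0; congr (fS _ _ _); by apply/setP => e; rewrite !inE.
Qed.

Lemma fmod_mono j F G : F \subset G -> G \subset Ej j -> fmod j F <= fmod j G.
Proof.
have [_ [_ [_ /(_ j)[_ [_ [fm _]]]]]] := wf => FG GE.
have FE := subset_trans FG GE; rewrite /fmod.
case: ifP => [/(subsetP FG) ->|_]; first by [].
by case: ifP => _; apply: fm; rewrite ?orig_sub ?origS.
Qed.

(** If exactly one of the sets contains the virtual edge, the top value cancels and monotonicity
    suffices. *)
Lemma fmod_submod j F G : F \subset Ej j -> G \subset Ej j ->
  fmod j (F :|: G) + fmod j (F :&: G) <= fmod j F + fmod j G.
Proof.
have [_ [_ [_ /(_ j)[_ [_ [fm fs]]]]]] := wf => FE GE.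
have oF := orig_sub FE; have oG := orig_sub GE.
have oU : orig (F :|: G) = orig F :|: orig G by apply/setP => e; rewrite !inE.
have oI : orig (F :&: G) = orig F :&: orig G by apply/setP => e; rewrite !inE.
rewrite /fmod !inE oU oI; case: (_ \in F); case: (_ \in G) => //=.
- by rewrite lerD2l; apply: fm => //; exact: subsetIr.
- by rewrite [leRHS]addrC lerD2l; apply: fm => //; exact: subsetIl.
- exact: fs.
Qed.

Lemma fsum0 : fsum (set0 : {set edge M}) = 0.
Proof. by rewrite /fsum big1 // => j _; rewrite set0I fmod0. Qed.

Lemma fsum_mono F G : F \subset G -> fsum F <= fsum G.
Proof.
by move=> FG; apply: ler_sum => j _; apply: fmod_mono; rewrite ?subsetIr ?setSI.
Qed.

Lemma fsum_submod F G : fsum (F :|: G) + fsum (F :&: G) <= fsum F + fsum G.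
Proof.
rewrite /fsum -!big_split /=; apply: ler_sum => j _.
rewrite setIUl (_ : F :&: G :&: Ej j = (F :&: Ej j) :&: (G :&: Ej j)).
  by apply: fmod_submod; exact: subsetIr.
by rewrite setIACA setIid.
Qed.

(** [fibM S] also contains pairs that are not edges; [fsum] ignores them. *)
Lemma fsum_fib S : fsum (fibM S) = fsum (Eset S).
Proof.
apply: eq_bigr => j _; congr (fmod _ _); apply/setP => e; rewrite !inE.
by case: (Defs.inE e); rewrite ?andbF.
Qed.

Lemma fsum_Ej j F : F \subset Ej j -> fsum F = fmod j F.
Proof.
move=> FE; rewrite /fsum (bigD1 j) //= big1 => [|j' jj'].
  by rewrite addr0; congr (fmod _ _); apply/setIidPl.
rewrite (_ : F :&: _ = set0) ?fmod0 //; apply/setP => e; rewrite !inE.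
apply/negP => /andP[/(subsetP FE)]; rewrite !inE => /andP[_ /eqP ->] /andP[_ /eqP jj].
by rewrite jj eqxx in jj'.
Qed.

(** Constraints of separate sellers add up. A pair that is not an edge has [fsum] equal to [0],
    which forces its amount to vanish. *)
Lemma inP_fsum w : inP w <->
  (forall e, 0 <= w e) /\ forall F, \sum_(e in F) w e <= fsum F.
Proof.
split=> [[w0 [wp wF]]|[wp wF]].
  split=> // F; rewrite (partition_big snd predT) //=; apply: ler_sum => j _.
  apply: le_trans (wF j (F :&: Ej j) (subsetIr _ _)); rewrite /wsum.
  rewrite big_mkcond [leRHS]big_mkcond /=; apply: ler_sum => e _; rewrite !inE.
  by case: (boolP (Defs.inE e)) => [_|/w0 ->]; rewrite /= ?if_same.
split=> [e ne|]; last by split=> // j F FE; rewrite -(fsum_Ej FE); exact: wF.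
apply/eqP; rewrite eq_le wp andbT; have := wF [set e]; rewrite big_set1.
move/le_trans; apply; rewrite /fsum big1 // => j _.
rewrite (_ : _ :&: _ = set0) ?fmod0 //; apply/setP => e'; rewrite !inE.
by case: eqP => //= ->; rewrite (negPf ne).
Qed.

Lemma wsum_fib y S : (forall e, ~~ Defs.inE e -> y e = 0) ->
  wsum y (Eset S) = \sum_(e in fibM S) y e.
Proof.
move=> y0; rewrite /wsum big_mkcond [RHS]big_mkcond /=; apply: eq_bigr => e _.
by rewrite !inE; case: (boolP (Defs.inE e)) => //= /y0 ->; rewrite if_same.
Qed.

Lemma inPwd_intro w d y : inP w -> (forall e, 0 <= y e) ->
  (forall F, \sum_(e in F) (w e + y e) <= fsum F) ->
  (forall k, le_dem (\sum_(e in fibM [set k]) y e) (d k)) -> inPwd w d y.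
Proof.
move=> iw y0 yF yd; have [w0 [wp _]] := iw.
have iy : inP (fun e => w e + y e) by apply/inP_fsum; split=> // e; rewrite addr_ge0.
have y00 e : ~~ Defs.inE e -> y e = 0.
  by move=> ne; have := iy.1 e ne; rewrite w0 // add0r.
by split=> //; split=> //; split=> // k; rewrite /Ei wsum_fib.
Qed.

(** [aggP] supplies allocations behind realizable vectors, and a zero coordinate [i] corresponds to
    empty edges of [i]. *)
Lemma clinchable_eclinch w d i xi : inP w -> (forall k, le_dem 0 (d k)) ->
  clinchable w d i xi <-> eclinch fst (@fsum R M) w d i xi.
Proof.
move=> iw d0; have [w0 [wp _]] := iw; have [_ wF] := (inP_fsum w).1 iw.
have zero_out y0 : (forall e, 0 <= y0 e) ->
    (forall F, \sum_(e in F) (w e + y0 e) <= fsum F) ->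
    forall F, \sum_(e in F) (w e + if e \in Ei i then 0 else y0 e) <= fsum F.
  move=> yp yF F; apply: le_trans (yF F); apply: ler_sum => e _.
  by rewrite lerD2l; case: ifP.
split=> [[xi0 [xp hxi]]|[xi0 xp xd hxi]].
  have xoff e : ~~ Defs.inE e -> xi e = 0.
    by move=> ne; apply: xi0; rewrite !inE (negPf ne).
  have xoff1 e : e.1 != i -> xi e = 0.
    by move=> ne; apply: xi0; rewrite !inE (negPf ne) andbF.
  have wsum0 k : wsum (fun _ : edge M => 0 : R) (Ei k) = 0 by rewrite /wsum big1.
  (* The zero vector lies in [P^i(0)], hence in [P^i(xi)]; its witness agrees with [xi] at [i] and
     yields the demand bound. *)
  have := (hxi (fun _ => 0)).2; case.
    split=> //; exists (fun _ => 0); split; last by split.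
    apply: inPwd_intro => // [F|k]; last by rewrite big1.
    by under eq_bigr do rewrite addr0.
  move=> _ [y [[y00 [yp [_ yd]]] [yxi _]]].
  split=> // [|u [gu ud] ui].
    have := yd i; rewrite /Ei wsum_fib //; congr (le_dem _ _).
    apply: eq_bigr => e ei; have [ne|ne] := boolP (Defs.inE e).
      by apply: yxi; rewrite inE ne; move: ei; rewrite inE.
    by rewrite y00 // xoff.
  have [z [z0 zF zk]] := (aggP _ fsum0 fsum_submod _ _).1 gu.
  have Pz : inPwd w d z by apply: inPwd_intro => // k; rewrite zk.
  have [_ [y' [[y'00 [y'p [y'P y'd]]] [y'xi y'k]]]] :
      inPi w d i xi u.
    apply/hxi; split=> [k _|]; first exact: gu.1.
    exists z; split=> //; split=> [e ei|k ki]; last first.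
      by rewrite /Ei wsum_fib ?zk //; exact: Pz.1.
    apply/eqP; rewrite eq_le z0 andbT.
    have := zk i; rewrite ui => {}ui; rewrite -ui.
    rewrite (bigD1 e) /=; last by move: ei; rewrite !inE => /andP[].
    by rewrite lerDl sumr_ge0.
  apply/(aggP _ fsum0 fsum_submod); exists (fun e => y' e - xi e); split=> [e|F|k].
  - have [ei|ei] := boolP (e \in Ei i); first by rewrite y'xi // subrr.
    by rewrite xi0 // subr0.
  - have [_ /(_ F)] := (inP_fsum _).1 y'P; congr (_ <= _).
    by apply: eq_bigr => e _; ring.
  rewrite sumrB; have [ki|ki] := eqVneq k i; last first.
    rewrite -(y'k k ki) /Ei wsum_fib // [X in _ - X]big1 ?subr0 // => e.
    by rewrite !inE => /eqP ek; apply: xoff1; rewrite ek.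
  rewrite ki ui -sumrB big1 // => e; rewrite !inE => /eqP ei.
  have [ne|ne] := boolP (Defs.inE e); last by rewrite y'00 // xoff // subrr.
  by rewrite y'xi ?subrr // !inE ne ei eqxx.
have D0 : dem_agg fst (@fsum R M) w d (fun _ => 0).
  split=> //; apply/(aggP _ fsum0 fsum_submod); exists (fun _ => 0).
  split=> // [F|k]; last by rewrite big1.
  by under eq_bigr do rewrite addr0.
have xoff e : ~~ Defs.inE e -> xi e = 0.
  have g0 := hxi _ D0 (erefl _); have [z [z0 zF zk]] := (aggP _ fsum0 fsum_submod _ _).1 g0.
  have : inP (fun e => w e + xi e + z e).
    by apply/inP_fsum; split=> // e'; rewrite !addr_ge0.
  case=> /(_ e) h _ ne; move: (h ne) (xp e) (z0 e); rewrite w0 // add0r; lra.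
split=> [e|]; first by rewrite !inE; case: (boolP (Defs.inE e)) => [_ /xi0|/xoff].
(* One inclusion empties the edges of [i]; the other zeroes coordinate [i], uses the clinching
   condition and puts [xi] back. *)
split=> // u; split=> -[up [y [[y00 [yp [yP yd]]] [yxi yk]]]]; split=> //.
  have yF := ((inP_fsum _).1 yP).2.
  exists (fun e => if e \in Ei i then 0 else y e); split.
    apply: inPwd_intro => // [e|F|k]; [by case: ifP|exact: zero_out|].
    apply: le_demW (yd k); rewrite /Ei wsum_fib //; apply: ler_sum => e _; by case: ifP.
  split=> [e ->//|k ki]; rewrite -(yk k ki); apply: eq_bigr => e.
  by rewrite !inE => /andP[-> /eqP ->]; rewrite (negPf ki) andbF.
pose u0 k := if k == i then 0 else u k.
have Du0 : dem_agg fst (@fsum R M) w d u0.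
  split=> [|k]; last first.
    by rewrite /u0; case: eqP => [_|/eqP ki]; [exact: d0 | rewrite -(yk k ki)].
  apply/(aggP _ fsum0 fsum_submod); exists y; split=> // [F|k].
    by have [_ /(_ F)] := (inP_fsum _).1 yP.
  rewrite /u0 -wsum_fib //; case: eqP => [->|/eqP ki]; last exact: yk.
  by rewrite /wsum big1 // => e ei; rewrite yxi.
have [|z [z0 zF zk]] := (aggP _ fsum0 fsum_submod _ _).1 (hxi _ Du0 _).
  by rewrite /u0 eqxx.
have Pxz : inPwd w d (fun e => xi e + z e).
  apply: inPwd_intro => // [e|F|k]; first exact: addr_ge0.
    by apply: le_trans (zF F); apply: ler_sum => e _; rewrite addrA.
  rewrite big_split /= zk /u0; case: eqP => [->|/eqP ki]; first by rewrite addr0.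
  rewrite big1 ?add0r => [|e]; first by rewrite -(yk k ki).
  by rewrite !inE => /eqP ek; apply: xi0; rewrite ek.
exists (fun e => xi e + z e); split=> //; split=> [e ei|k ki].
  have ei' : e \in fibM [set i] by move: ei; rewrite !inE => /andP[].
  suff -> : z e = 0 by rewrite addr0.
  apply/eqP; rewrite eq_le z0 andbT; have := zk i; rewrite /u0 eqxx => h; rewrite -h.
  by rewrite (bigD1 e) //= lerDl sumr_ge0.
rewrite /Ei wsum_fib; last exact: Pxz.1.
rewrite big_split /= zk /u0 (negPf ki) big1 ?add0r // => e.
by rewrite !inE => /eqP ek; apply: xi0; rewrite ek.
Qed.


(** * Demands and the invariant of the auction *)

Local Notation demandM := (demand (@vN R M)).
Local Notation no_clinch s := (no_eclinch fst (@fsum R M) (sw s) (sd s)).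

Lemma bN_ge0 (k : agent M) b : bN k = Some b -> 0 <= b.
Proof.
by rewrite /bN; case: (split k) => // i [<-]; have [_ [/(_ i)]] := wf.
Qed.

Lemma demand_local p c p' c' (k : agent M) : p k = p' k -> c k = c' k ->
  demandM p c k = demandM p' c' k.
Proof. by rewrite /demand => -> ->. Qed.

(** Paying [c i * a] lowers a finite demand below the valuation by exactly [a]; from the valuation
    on, zero demand forces [a = 0]. *)
Lemma demand_clinch p p' c (i : agent M) (a : R) : 0 <= a ->
  le_dem a (demandM p c i) ->
  (forall k, p' k = if k == i then p k + c k * a else p k) ->
  dem_step (demandM p c) (demandM p' c) i a.
Proof.
move=> a0 ad p'E k b; have [->|ki] := eqVneq k i; last first.
  by rewrite addr0 (@demand_local p' c p c) // p'E (negPf ki).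
move: ad; rewrite /demand p'E eqxx; case: eqP => // /eqP c0; case: ifP => _.
  case: (bN i) => //= B _.
  have -> : (B - (p i + c i * a)) / c i = (B - p i) / c i - a by field.
  by rewrite lerBrDr.
move=> /= ad; have -> : a = 0 by apply/eqP; rewrite eq_le ad.
by rewrite addr0.
Qed.

Lemma demand_ge0 p c (k : agent M) : 0 <= c k ->
  (forall b, bN k = Some b -> p k <= b) -> le_dem 0 (demandM p c k).
Proof.
move=> c0 pb; rewrite /demand; case: ifP => // _; case: ifP => _ /=; last by [].
by case: (bN k) pb => //= b /(_ _ erefl) pb; rewrite divr_ge0 ?subr_ge0.
Qed.

Lemma demand_raise p c c' (k : agent M) b : 0 <= c k -> c k <= c' k ->
  (forall B, bN k = Some B -> p k <= B) -> 0 <= b ->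
  le_dem b (demandM p c' k) -> le_dem b (demandM p c k).
Proof.
move=> c0 cc' pB b0; have := demand_ge0 c0 pB; rewrite /demand.
case: eqP => // /eqP ck0; have cp : 0 < c k by rewrite lt_neqAle eq_sym ck0.
have cp' : 0 < c' k by exact: lt_le_trans cc'.
rewrite gt_eqF //; have [c'v _|c'v h] := ltP (c' k) (vN k); last first.
  by move=> /= b0'; apply: le_demW h.
rewrite (le_lt_trans cc' c'v); case: (bN k) pB => //= B /(_ _ erefl) pB /le_trans.
by apply; rewrite ler_wpM2l ?subr_ge0 // lef_pV2.
Qed.

Lemma demand0_exhausted p c (k : agent M) : demandM p c k = Some 0 -> c k < vN k ->
  bN k = Some (p k).
Proof.
rewrite /demand => + cv; rewrite cv; case: eqP => // /eqP c0.
case: (bN k) => // b [] /eqP; rewrite mulf_eq0 invr_eq0 (negPf c0) orbF subr_eq0.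
by move=> /eqP ->.
Qed.

Lemma demand0_raise p c c' (k : agent M) : 0 <= c k -> c k <= c' k ->
  demandM p c k = Some 0 -> demandM p c' k = Some 0.
Proof.
move=> c0 cc' d0; have cp : 0 < c k.
  rewrite lt_neqAle c0 andbT; apply/eqP => ck; move: d0.
  by rewrite /demand -ck eqxx.
rewrite /demand gt_eqF; last exact: lt_le_trans cc'.
have [c'v|//] := ltP (c' k) (vN k).
by rewrite (demand0_exhausted d0) ?subrr ?mul0r //; exact: le_lt_trans c'v.
Qed.

Lemma demandN0_lt p c (k : agent M) : 0 < vN k -> demandM p c k != Some 0 -> c k < vN k.
Proof.
by move=> vk; rewrite /demand; have [->//|_] := eqVneq (c k) 0; case: ifP; rewrite ?eqxx.
Qed.

(** [inv_pay] turns a spent budget into [b <= vN l * xf s l]; [inv_drop] prepares the alternative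
    needed at termination. *)
Record pca_inv (s : pstate M) : Prop := PcaInv {
  inv_P : inP (sw s);
  inv_demand k : sd s k = demandM (sp s) (sc s) k;
  inv_clock k : 0 <= sc s k;
  inv_pay k : sp s k <= vN k * xf s k;
  inv_budget k b : bN k = Some b -> sp s k <= b;
  inv_refund : refund_inv fst (@fsum R M) (sw s) (sd s);
  inv_drop l : vN l <= sc s l ->
    (exists2 b, bN l = Some b & b <= vN l * xf s l) \/
    exists A : {set agent M}, [/\ l \in A, forall k, k \in A -> vN l <= vN k &
      reserved fst (@fsum R M) A (sw s) (sd s)] }.

Lemma inv_dem0 s k : pca_inv s -> le_dem 0 (sd s k).
Proof.
by move=> I; rewrite (inv_demand I); apply: demand_ge0;
  [exact: inv_clock | exact: inv_budget].
Qed.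

Lemma dem_agg0 s : pca_inv s ->
  dem_agg fst (@fsum R M) (sw s) (sd s) (fun _ => 0).
Proof.
move=> I; split=> [|k]; last exact: inv_dem0.
have [_ wF] := (inP_fsum _).1 (inv_P I).
by split=> // S F _; rewrite big1 // add0r.
Qed.

Lemma xfE s k : inP (sw s) -> xf s k = \sum_(e in fibM [set k]) sw s e.
Proof. by move=> [w0 _]; rewrite /xf /Ei wsum_fib. Qed.

Hypothesis v_gt0 : forall k : agent M, 0 < vN k.

Lemma clinch_one_inv i s s' : pca_inv s -> clinch_one (@vN R M) i s s' ->
  [/\ pca_inv s', no_clinch s' i, forall k, no_clinch s k -> no_clinch s' k,
      sc s' = sc s & sl s' = sl s].
Proof.
move=> I [xi [[cl xmax] ->]] /=; set p' := fun k : agent M => if k == i then _ else _.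
have iw := inv_P I; have d0 k := inv_dem0 k I.
have ec := (clinchable_eclinch i xi iw d0).1 cl.
have [xi1 xp xd hxi] := ec.
have xioff e : ~~ Defs.inE e -> xi e = 0.
  by move=> ne; case: cl => h _; apply: h; rewrite !inE (negPf ne).
set a := \sum_(e in fibM [set i]) xi e in xd.
have aE : wsum xi (Ei i) = a by rewrite /Ei wsum_fib.
have a0 : 0 <= a by exact: sumr_ge0.
have dd' : dem_step (sd s) (demandM p' (sc s)) i a.
  have h : dem_step (demandM (sp s) (sc s)) (demandM p' (sc s)) i a.
    apply: demand_clinch => // [|k]; first by rewrite -(inv_demand I).
    by rewrite /p' aE.
  by move=> k b; rewrite (inv_demand I).
have iw' : inP (fun e => sw s e + xi e).
  have [w0 [wp _]] := iw.
  have := hxi _ (dem_agg0 I) (erefl _).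
  move=> [_ hF]; apply/inP_fsum; split=> [e|F]; first exact: addr_ge0.
  by have := hF set0 F; rewrite big_set0 add0r; apply; apply/subsetP => e; rewrite !inE.
have own : no_clinch (St (fun e => sw s e + xi e) p' (sc s) (demandM p' (sc s)) (sl s)) i.
  apply: (no_eclinch_own ec) dd' => xi' /(clinchable_eclinch i xi' iw d0) cl' le e.
  exact: xmax.
have xfS k : wsum (fun e => sw s e + xi e) (Ei k) = xf s k + if k == i then a else 0.
  rewrite /wsum big_split /= -/(wsum xi (Ei k)); congr (_ + _).
  rewrite /Ei wsum_fib //; case: eqP => [->//|/eqP ki]; rewrite big1 // => e.
  by rewrite !inE => /eqP ek; apply: xi1; rewrite ek.
have xfS_ge k : xf s k <= wsum (fun e => sw s e + xi e) (Ei k).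
  by rewrite xfS lerDl; case: ifP.
split=> //=; last first.
  move=> k nk; have [->//|ki] := eqVneq k i.
  exact: (no_eclinch_other ec dd' ki nk).
split=> //=; first exact: inv_clock.
- move=> k; rewrite /xf xfS /p' aE; have := inv_pay I k.
  case: eqP => [->|_]; last by rewrite addr0.
  (* Below the valuation a unit costs less than its value; from there on the demand is zero, so
     [a = 0]. *)
  have : sc s i * a <= vN i * a; last by rewrite mulrDr; lra.
  have [ci|ci] := ltP (sc s i) (vN i); first by rewrite ler_wpM2r // ltW.
  move: xd; rewrite (inv_demand I) /demand gt_eqF; last exact: lt_le_trans ci.
  rewrite ltNge ci /= => xd; suff -> : a = 0 by rewrite !mulr0.
  by apply/eqP; rewrite eq_le xd.
- move=> k b kb; rewrite /p' aE; have := inv_budget I kb; case: eqP => // ki pb.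
  subst k; have := xd; rewrite (inv_demand I) /demand kb.
  have := inv_clock I i; rewrite le_eqVlt => /predU1P[<-|ci].
    by rewrite mul0r addr0.
  rewrite gt_eqF //; case: ifP => _ /= h; last first.
    have -> : a = 0 by apply/eqP; rewrite eq_le h.
    by rewrite mulr0 addr0.
  by move: h; rewrite ler_pdivlMr // mulrC; lra.
- exact: (refund_inv_clinch ec dd' (inv_refund I)).
move=> l /(inv_drop I) [[b lb xb]|[A [lA Av rA]]]; [left|right].
  by exists b => //; apply: le_trans xb _; rewrite ler_pM2l // xfS_ge.
by exists A; split=> //; exact: (reserved_clinch ec dd' rA).
Qed.

Lemma clinch_seq_inv l s s' : pca_inv s -> clinch_seq (@vN R M) l s s' ->
  [/\ pca_inv s', forall k, k \in l -> no_clinch s' k,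
      forall k, no_clinch s k -> no_clinch s' k, sc s' = sc s & sl s' = sl s].
Proof.
elim: l s => [|i l IH] s I /=; first by move=> ->.
move=> [s1 [/(clinch_one_inv I)[I1 n1 k1 c1 l1] /(IH _ I1)[I2 n2 k2 c2 l2]]].
split=> // [k|k /k1/k2//||].
- by rewrite inE => /predU1P[->|/n2//]; exact: k2.
- by rewrite c2.
- by rewrite l2.
Qed.

(** * Price clocks and termination *)

Variable eps : R.
Hypothesis eps_gt0 : 0 < eps.
Hypothesis v_eps : forall k : agent M, exists q : nat, (0 < q)%N /\ vN k = q%:R * eps.

(** Agents before the pointer are one step ahead; the guard is for the empty market. *)
Definition clocks t (s : pstate M) := (0 < nB M + nS M -> sl s < nB M + nS M)%N /\
  forall k, sc s k = (t + (k < sl s))%N%:R * eps.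

Lemma price_step_clocks t s : clocks t s ->
  exists t', clocks t' (price_step (@vN R M) eps s).
Proof.
move=> [sn ck]; set n := (nB M + nS M)%N in sn *.
have [n0|n0] := posnP n.
  exists 0%N; split=> [|k]; first by rewrite -/n n0.
  by exfalso; have := leq_ltn_trans (leq0n k) (ltn_ord k); rewrite -/n n0.
have {}sn := sn n0.
have c'E k : sc (price_step (@vN R M) eps s) k = (t + (k < (sl s).+1))%N%:R * eps.
  rewrite /= ck ltnS [(k <= _)%N]leq_eqVlt.
  have [->|_] := eqVneq (nat_of_ord k) (sl s); last by [].
  by rewrite ltnn addn0 natrD mulrDl mul1r.
have [sn'|sn'] := ltnP (sl s).+1 n.
  exists t; split=> [_|k]; first by rewrite /= -/n modn_small.
  by rewrite c'E /= -/n modn_small.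
have sl' : (sl s).+1 = n by apply/eqP; rewrite eqn_leq sn sn'.
exists t.+1; split=> [_|k]; first by rewrite /= -/n ltn_mod.
by rewrite c'E /= -/n sl' modnn ltn0 addn0 ltn_ord addn1.
Qed.

Lemma price_step_inv t s : pca_inv s -> (forall k, no_clinch s k) -> clocks t s ->
  pca_inv (price_step (@vN R M) eps s).
Proof.
move=> I noc [sn ck].
set s' := price_step _ _ _.
have clock_le k : sc s k <= sc s' k.
  by rewrite /=; case: ifP => // _; rewrite lerDl ltW.
have dem' k : sd s' k = demandM (sp s') (sc s') k.
  rewrite /=; case: ifP => // kl; rewrite (inv_demand I); apply: demand_local => //=.
  by rewrite kl.
have other k : nat_of_ord k != sl s -> sd s' k = sd s k.
  by move=> /negPf kl; rewrite /= kl.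
have c'0 k : 0 <= sc s' k by apply: le_trans (clock_le k); exact: (inv_clock I).
have d0' k : le_dem 0 (sd s' k).
  by rewrite dem'; apply: demand_ge0; [exact: c'0 | exact: (inv_budget I)].
have d00 k : sd s k = Some 0 -> sd s' k = Some 0.
  by rewrite (inv_demand I) dem'; apply: demand0_raise => //; exact: (inv_clock I).
have keep (A : {set agent M}) : reserved fst (@fsum R M) A (sw s) (sd s) ->
    reserved fst (@fsum R M) A (sw s') (sd s').
  have [[l ll]|nol] : (exists l : agent M, nat_of_ord l = sl s) \/
      (forall l : agent M, nat_of_ord l != sl s).
    have [/existsP[l /eqP ll]|/existsPn h] :=
      boolP [exists l : agent M, nat_of_ord l == sl s]; by [left; exists l|right].
    apply: (reserved_price fsum0 fsum_submod (dem_agg0 I) (noc l)) => // [k kl|].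
      by apply: other; rewrite -ll; apply: contraNneq kl => /val_inj ->.
    exact: d00.
  move=> [dA [u [gu ud] uA]]; split=> [k /dA/d00//|].
  by exists u => //; split=> // k; rewrite other.
split=> //.
- exact: (inv_P I).
- exact: (inv_pay I).
- exact: (inv_budget I).
- apply: refund_inv_dem (inv_refund I) _ => k b b0.
  rewrite dem' (inv_demand I); apply: demand_raise => //; first exact: (inv_clock I).
  exact: (inv_budget I).
move=> l vl.
have [cl|cl] := leP (vN l) (sc s l).
  have [?|[A [lA Av /keep rA]]] := inv_drop I cl; first by left.
  by right; exists A.
have [dl|dl] := eqVneq (sd s l) (Some 0).
  left; rewrite (inv_demand I) in dl; exists (sp s l); last exact: (inv_pay I).
  exact: (demand0_exhausted dl).
(* Here [l] drops out with nonzero demand, and the agents active before the price step serve as the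
   reserved set. *)
right; exists [set k | sd s k != Some 0]; split; first by rewrite inE.
  move=> k; rewrite inE (inv_demand I) => /(demandN0_lt (v_gt0 k)).
  move: vl cl; rewrite /=; case: eqP => [sl_l|_] vl; last by rewrite ltNge vl.
  (* In units of [eps], the clock of [l] goes from [t] to [t.+1] and reaches its value [q]. An
     active [k] has clock at least [t] and below its value [q'], hence [q <= t.+1 <= q']. *)
  rewrite ck; move: vl; rewrite !ck -sl_l ltnn addn0.
  have [q [_ ->]] := v_eps l; have [q' [_ ->]] := v_eps k.
  rewrite -[X in _ + X]mul1r -mulrDl natr1 !(ler_pM2r, ltr_pM2r) //.
  rewrite !ler_nat !ltr_nat => h1 h2 h3.
  exact: leq_trans h1 (leq_ltn_trans (leq_addr _ _) h3).
apply: keep; apply: (reserved_active fsum0 fsum_submod fsum_mono) => //.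
- exact: (dem_agg0 I).
- by case: (inv_P I) => _ [].
- exact: (inv_refund I).
Qed.

Lemma pca_runs_inv s s' : pca_runs (@vN R M) eps s s' -> pca_inv s ->
  (exists t, clocks t s) -> pca_inv s' /\ forall k, sd s' k = Some 0.
Proof.
elim=> [{}s d0 //|{}s s1 s2 _ [s3 [cs ->]] _ IH I [t ct]].
have [I3 n3 _ c3 l3] := clinch_seq_inv I cs.
have ct3 : clocks t s3 by rewrite /clocks c3 l3.
apply: IH; last exact: (price_step_clocks ct3).
by apply: (price_step_inv I3 _ ct3) => k; apply: n3; rewrite mem_enum.
Qed.

Lemma pca_inv_init : pca_inv (@pca_init R M).
Proof.
split=> //=.
- apply/inP_fsum; split=> // F; rewrite big1 // -fsum0; apply: fsum_mono.
  exact: sub0set.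
- by move=> k; rewrite /demand eqxx.
- by move=> k; rewrite /xf /wsum big1 // mulr0.
- by move=> k b /bN_ge0.
- by move=> K u + _ _; apply: agg_ext => e; rewrite if_same.
- by move=> l; rewrite leNgt v_gt0.
Qed.

(** Zero demands make the witness of [reserved] vanish, so nothing is left on [fibM A]; a clock
    still below the valuation means a spent budget. *)
Lemma pca_final_tight s : pca_inv s -> (forall k, sd s k = Some 0) ->
  forall l, (exists2 b, bN l = Some b & b / vN l <= xf s l) \/
  exists A : {set agent M}, [/\ l \in A, forall k, k \in A -> vN l <= vN k &
    fsum (fibM A) <= \sum_(k in A) xf s k].
Proof.
move=> I d0 l.
suff [[b lb xb]|[A [lA Av [_ [u [[u0 _] ud] uA]]]]] :
  (exists2 b, bN l = Some b & b <= vN l * xf s l) \/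
    exists A : {set agent M}, [/\ l \in A, forall k, k \in A -> vN l <= vN k &
      reserved fst (@fsum R M) A (sw s) (sd s)].
- by left; exists b => //; rewrite ler_pdivrMr // mulrC.
- right; exists A; split=> //; apply: le_trans uA _.
  rewrite big1 ?add0r => [|k _].
    rewrite sum_fib; apply: ler_sum => k _; rewrite xfE //; exact: (inv_P I).
  by apply/eqP; rewrite eq_le u0 andbT; have := ud k; rewrite d0.
have [|cl] := leP (vN l) (sc s l); first exact: (inv_drop I).
left; exists (sp s l); last exact: inv_pay.
by apply: demand0_exhausted cl; rewrite -(inv_demand I).
Qed.

(** * The greedy vector *)

Lemma Hset_notin (i : agent M) (H : {set agent M}) : H \subset Hset i -> i \notin H.
Proof. by move=> /subsetP HH; apply/negP => /HH; rewrite inE ltxx ltnn andbF. Qed.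

Lemma Hset_total (i k : agent M) : i != k -> (k \in Hset i) || (i \in Hset k).
Proof.
move=> ik; rewrite !inE; case: (ltgtP (vN i) (vN k)) => //= _.
by rewrite orbC -neq_ltn.
Qed.

Lemma Hset_le (i k : agent M) : k \in Hset i -> vN i <= vN k.
Proof. by rewrite inE => /orP[/ltW|/andP[/eqP -> _]]. Qed.

Lemma Hset_trans (i k m : agent M) : k \in Hset i -> m \in Hset k -> m \in Hset i.
Proof.
rewrite !inE => /orP[ik|/andP[/eqP ki k_i]] /orP[km|/andP[/eqP mk m_k]].
- by rewrite (lt_trans ik km).
- by rewrite mk ik.
- by rewrite -ki km.
- by rewrite mk ki eqxx (ltn_trans m_k k_i) orbT.
Qed.

Lemma Hset_rank (i k : agent M) : k \in Hset i -> (#|Hset k| < #|Hset i|)%N.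
Proof.
move=> ki; apply: proper_card; apply/properP; split.
  by apply/subsetP => m; exact: Hset_trans.
by exists k => //; exact: Hset_notin.
Qed.

(** The value of [i] is written once, at step [#|Hset i|.+1], and kept. *)
Lemma xstar_iter_stable t (i : agent M) : (#|Hset i| < t)%N ->
  xstar_iter M t i = xstar_val (xstar_iter M #|Hset i|) i.
Proof.
elim: t => // t IH; rewrite ltnS leq_eqVlt /= ffunE => /predU1P[->|it].
  by rewrite eqxx.
by rewrite (ltn_eqF it) IH.
Qed.

Lemma xstar_val_ext x x' (i : agent M) : (forall k, k \in Hset i -> x k = x' k) ->
  xstar_val x i = xstar_val x' i.
Proof.
move=> xx'; rewrite /xstar_val.
suff -> : \big[Num.min/fsum (Eset [set i])]_(H in powerset (Hset i))
      (fsum (Eset (i |: H)) - \sum_(k in H) x k) =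
    \big[Num.min/fsum (Eset [set i])]_(H in powerset (Hset i))
      (fsum (Eset (i |: H)) - \sum_(k in H) x' k) by [].
apply: eq_bigr => H; rewrite inE => /subsetP HH; congr (_ - _).
by apply: eq_bigr => k /HH/xx'.
Qed.

Lemma xstar_fix (i : agent M) : xstar i = xstar_val (@xstar R M) i.
Proof.
have rank (k : agent M) : (#|Hset k| < nB M + nS M)%N.
  have : Hset k \proper [set: agent M].
    by apply/properP; split=> //; exists k; rewrite ?Hset_notin.
  by move/proper_card; rewrite cardsT card_ord.
rewrite {1}/xstar xstar_iter_stable //; apply: xstar_val_ext => k ki.
by rewrite /xstar (xstar_iter_stable (Hset_rank ki)) (xstar_iter_stable (rank k)).
Qed.

Lemma xstar_attained (i : agent M) :
  (exists2 b, bN i = Some b & xstar i = b / vN i) \/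
  exists2 H : {set agent M}, H \subset Hset i &
    xstar i = fsum (Eset (i |: H)) - \sum_(k in H) xstar k.
Proof.
have capP : exists2 H : {set agent M}, H \subset Hset i &
    \big[Num.min/fsum (Eset [set i])]_(H in powerset (Hset i))
      (fsum (Eset (i |: H)) - \sum_(k in H) xstar k) =
    fsum (Eset (i |: H)) - \sum_(k in H) xstar k.
  apply: (big_ind (fun r => exists2 H : {set agent M}, H \subset Hset i &
    r = fsum (Eset (i |: H)) - \sum_(k in H) xstar k)).
  (* The initial value of the minimum is the term of the empty set. *)
  - by exists set0; rewrite ?sub0set // setU0 big_set0 subr0.
  - move=> x y [H HH ->] [H' HH' ->].
    by case: (leP (fsum (Eset (i |: H)) - _)) => _; [exists H | exists H'].
  - by move=> H; rewrite inE => HH; exists H.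
move: (xstar_fix i) capP; rewrite /xstar_val; set cap := \big[_/_]_(_ in _) _.
case: (bN i) => [b|] ->; last by right.
by case: leP => _ capP; [left; exists b | right].
Qed.

Lemma xstar_le_cap (i : agent M) (H : {set agent M}) : H \subset Hset i ->
  xstar i <= fsum (Eset (i |: H)) - \sum_(k in H) xstar k.
Proof.
move=> HH; rewrite xstar_fix /xstar_val; set cap := \big[_/_]_(_ in _) _.
have capH : cap <= fsum (Eset (i |: H)) - \sum_(k in H) xstar k.
  by apply: bigmin_le_cond; rewrite inE.
by case: (bN i) => // b; rewrite ge_min capH orbT.
Qed.

Lemma xstar_le_budget (i : agent M) b : bN i = Some b -> xstar i <= b / vN i.
Proof. by move=> ib; rewrite xstar_fix /xstar_val ib ge_min lexx. Qed.

(** For the last agent [i] of [S] in the order, [S :\ i] lies in [Hset i], and the cap of [i] for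
    that set is the claim. *)
Lemma xstar_le_fsum (S : {set agent M}) : \sum_(k in S) xstar k <= fsum (Eset S).
Proof.
have [->|[i0 i0S]] := set_0Vmem S.
  by rewrite big_set0 -fsum0; apply: fsum_mono; exact: sub0set.
case: (arg_maxnP (fun k => #|Hset k|) i0S) => i iS imax.
have := @xstar_le_cap i (S :\ i); rewrite setD1K // lerBrDr -big_setD1 //; apply.
apply/subsetP => k; rewrite in_setD1 => /andP[ki kS].
have /orP[/Hset_rank|//] := Hset_total ki.
by rewrite ltnNge (imax k kS : (_ <= _)%N).
Qed.

Lemma xstar_ge0 (i : agent M) : 0 <= xstar i.
Proof.
have [[b ib ->]|[H HH ->]] := xstar_attained i.
  by rewrite divr_ge0 ?(bN_ge0 ib) // ltW.
rewrite subr_ge0; apply: le_trans (xstar_le_fsum H) _; apply: fsum_mono.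
by apply/subsetP => e; rewrite !inE => /andP[-> ->]; rewrite orbT.
Qed.

(** * Welfare comparisons *)

Lemma vN_dominance (z x : agent M -> R) :
  (forall S : {set agent M}, \sum_(k in S) z k <= fsum (fibM S)) ->
  (forall S : {set agent M}, \sum_(k in S) x k <= fsum (fibM S)) ->
  (forall l, z l <= x l \/ exists T : {set agent M}, [/\ l \in T,
     forall k, k \in T -> vN l <= vN k & fsum (fibM T) <= \sum_(k in T) x k]) ->
  \sum_(k : agent M) vN k * z k <= \sum_(k : agent M) vN k * x k.
Proof.
apply: tight_dominance => [|S T|k]; last exact: ltW.
  by rewrite (_ : fibM set0 = set0) ?fsum0 //; apply/setP => e; rewrite !inE.
by rewrite fibU fibI; exact: fsum_submod.
Qed.

Lemma wsum_le_fsum w (S : {set agent M}) : inP w ->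
  \sum_(k in S) wsum w (Ei k) <= fsum (fibM S).
Proof.
move=> iw; have [w0 _] := iw; apply: le_trans (((inP_fsum _).1 iw).2 _).
by rewrite sum_fib; apply: ler_sum => k _; rewrite /Ei wsum_fib.
Qed.

Lemma xstar_LWOPT : @is_LWOPT R M (\sum_(k : agent M) vN k * xstar k).
Proof.
split.
  have agx : agg fst (@fsum R M) (fun _ => 0) (@xstar R M).
    split=> [k|S F SF]; first exact: xstar_ge0.
    rewrite [X in _ + X]big1 // addr0; apply: le_trans (fsum_mono SF).
    by rewrite fsum_fib; exact: xstar_le_fsum.
  have [y [y0 yF yk]] := (aggP _ fsum0 fsum_submod _ _).1 agx.
  have iy : inP y.
    apply/inP_fsum; split=> // F; apply: le_trans (yF F).
    by under [leRHS]eq_bigr do rewrite add0r.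
  exists y; split=> //; apply: eq_bigr => k _.
  rewrite /Ei wsum_fib ?yk; last by case: iy.
  case kb : (bN k) => [b|] //; apply/min_idPl.
  by have := xstar_le_budget kb; rewrite ler_pdivlMr // mulrC.
move=> w iw.
(* Cutting amounts at the budgets makes liquid welfare a weighted sum. Each [xstar l] is either at
   its budget cap, hence at least [z l], or makes [l |: H] tight. *)
pose z k := if bN k is Some b then Num.min (wsum w (Ei k)) (b / vN k) else wsum w (Ei k).
have -> : LW w = \sum_(k : agent M) vN k * z k.
  apply: eq_bigr => k _; rewrite /z; case: (bN k) => // b.
  by rewrite minr_pMr ?ltW // mulrCA divff ?mulr1 // gt_eqF.
apply: vN_dominance => [S|S|l].
- apply: le_trans (wsum_le_fsum S iw); apply: ler_sum => k _; rewrite /z.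
  by case: (bN k) => // b; rewrite ge_min lexx.
- by rewrite fsum_fib; exact: xstar_le_fsum.
have [[b lb lx]|[H HH lx]] := xstar_attained l.
  by left; rewrite lx /z lb ge_min lexx orbT.
right; exists (l |: H); split=> [|k|]; first by rewrite !inE eqxx.
  by rewrite !inE => /predU1P[->//|/(subsetP HH)/Hset_le].
by rewrite big_setU1 ?(Hset_notin HH) //= lx subrK fsum_fib.
Qed.

Lemma pca_SW s : pca_runs (@vN R M) eps (@pca_init R M) s ->
  \sum_(k : agent M) vN k * xstar k <= SW_PCA s.
Proof.
move=> run; have [||I d0] := pca_runs_inv run.
- exact: pca_inv_init.
- by exists 0%N; split=> // k; rewrite /= mul0r.
apply: vN_dominance => [S|S|l].
- by rewrite fsum_fib; exact: xstar_le_fsum.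
- exact: (wsum_le_fsum S (inv_P I)).
have [[b lb xb]|] := pca_final_tight I d0 l; last by right.
by left; apply: le_trans xb; exact: xstar_le_budget.
Qed.

End Market.

Theorem theorem3p12 (R : realType) (M : market R) (eps : R) (sf : pstate M) :
  market_wf M -> 0 < eps ->
  (* truthful bids v' = v, all positive integer multiples of eps *)
  (forall k : agent M, exists q : nat, (0 < q)%N /\ vN k = q%:R * eps) ->
  pca_runs (@vN R M) eps (@pca_init R M) sf ->
  \sum_(k : agent M) vN k * @xstar R M k <= SW_PCA sf /\
  @is_LWOPT R M (\sum_(k : agent M) vN k * @xstar R M k).
Proof.
move=> wf eps0 v_eps run.
have v0 k : 0 < @vN R M k.
  by have [q [q0 ->]] := v_eps k; rewrite mulr_gt0 // ltr0n.
by split; [exact: (pca_SW wf v0 eps0 v_eps run) | exact: xstar_LWOPT].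
Qed.
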